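(* Consider the shifted mean detection problem with the class of sparse sets $\mathcal{C}=\{\mathcal{S}\subseteq[d]:|\mathcal{S}|=s^*\}$. Put $\zeta=d/(2s^{*2})$ and $\tau=\sqrt{\log(1/\xi)/n}$, and let $\delta>0$ be a sufficiently small constant. Let $T\ge1$ with $T=O(d^{\eta})$, where $\eta$ is any constant. Then $$\frac{T\cdot\sup_{q\in\mathcal{Q}}|\mathcal{C}(q)|}{|\mathcal{C}|}=o(1)$$ under any one of the following settings: (i).(a) $s^{*2}/d=o(1)$, $\lim_{d\to\infty}\zeta/d^{\delta}>0$, $\lim_{d\to\infty}\tau^2/\alpha^2>0$, and $\beta^*=o(1)$; (i).(b) $s^{*2}/d=o(1)$, $\lim_{d\to\infty}\zeta/d^{\delta}>0$, $\tau^2/\alpha^2=o(1)$, and $\beta^{*2}n\alpha^2=o(1)$; (i).(c) $s^{*2}/d=o(1)$, $\zeta/d^{\delta}=o(1)$, $\lim_{d\to\infty}\tau^2/\alpha^2>0$, and $\beta^{*2}\log d=o(1)$; (i).(d) $s^{*2}/d=o(1)$, $\zeta/d^{\delta}=o(1)$, $\tau^2/\alpha^2=o(1)$, and $\beta^{*2}n\alpha^2=o(1)$; (ii).(a) $\lim_{d\to\infty}s^{*2}/d>0$, $\tau^2/\alpha^2=o(1)$, and $\beta^{*2}s^{*2}n\alpha^2/d=o(1)$; (ii).(b) $\lim_{d\to\infty}s^{*2}/d>0$, $\lim_{d\to\infty}\tau^2/\alpha^2>0$, and $\beta^{*2}s^{*2}\log d/d=o(1)$.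
   Context: Setting: $\mathbb{P}_0=N(\mathbf{0},\mathbf{I}_d)$; for $\mathcal{S}\in\mathcal{C}$, $\mathbb{P}_{\mathcal{S}}=(1-\alpha)N(\mathbf{0},\mathbf{I}_d)+\alpha N(\boldsymbol{\theta}_{\mathcal{S}},\mathbf{I}_d)$ (mixture), where $\alpha\in(0,1]$, $(\boldsymbol{\theta}_{\mathcal{S}})_j=\beta^*>0$ for $j\in\mathcal{S}$ and $0$ otherwise. Asymptotics: $s^*,n,\alpha,\beta^*,\xi,T$ are sequences indexed by $d\to\infty$ with $s^*,n\to\infty$, $\alpha n\to\infty$, $\beta^*=o(1)$, $\xi\in[0,1/4)$; limits of all sequences considered are assumed to exist (in $[0,\infty]$). Queries: fix $b>0$; $\mathcal{Q}$ is the set of all (measurable) functions $q:\mathbb{R}^d\to[-b,b]$. For $q\in\mathcal{Q}$, $\mathcal{C}(q)=\{\mathcal{S}\in\mathcal{C}: |\mathbb{E}_{\mathbb{P}_{\mathcal{S}}}[q(\boldsymbol{X})]-\mathbb{E}_{\mathbb{P}_0}[q(\boldsymbol{X})]|>\overline{\tau}_q\}$, where $\overline{\tau}_q=\max\{\frac{2b}{3}\cdot\frac{\log(1/\xi)}{n},\sqrt{2\,\mathrm{Var}_{\mathbb{P}_0}[q(\boldsymbol{X})]\log(1/\xi)/n}\}$ ($\overline{\tau}_q=\tau=+\infty$ if $\xi=0$). *)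

(* Defs.v *)
From HB Require Import structures.
From mathcomp Require Import all_boot all_order all_algebra.
From mathcomp Require Import all_classical all_reals all_analysis.

Set Implicit Arguments.
Unset Strict Implicit.
Unset Printing Implicit Defensive.

Import Order.TTheory GRing.Theory Num.Theory.
Import numFieldNormedType.Exports.

Local Open Scope classical_set_scope.
Local Open Scope ring_scope.

Notation euclid R d := (d.-tuple (measurableTypeR R)).

Section prepend.
Context {R : realType} {d : nat}.

Definition prepend (z : measurableTypeR R * euclid R d) : euclid R d.+1 :=
  [tuple of z.1 :: z.2].

Let measurable_prepend : measurable_fun [set: _] prepend.
Proof. by apply: measurable_cons; [exact: measurable_fst|exact: measurable_snd]. Qed.

HB.instance Definition _ := isMeasurableFun.Build _ _ _ _
  prepend measurable_prepend.

End prepend.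

(* N(theta, I_d), as the product of the laws N(theta_j, 1). *)
Fixpoint gaussian {R : realType} {d : nat} :
    ('I_d -> R) -> probability (euclid R d) R :=
  match d return ('I_d -> R) -> probability (euclid R d) R with
  | 0 => fun=> dirac ([tuple] : euclid R 0)
  | d'.+1 => fun theta =>
      distribution (normal_prob (theta ord0) 1 \x
                    gaussian (fun j => theta (lift ord0 j)))%E prepend
  end.

Section mixture.
Context {dd : measure_display} {X : measurableType dd} {R : realType}.
Variables (a : {i01 R}) (P Q : probability X R).

Definition mixture : set X -> \bar R :=
  measure_add (mscale (1 - a%:num)%:nng P) (mscale (a%:num)%:nng Q).

HB.instance Definition _ := Measure.on mixture.

Let mixture_setT : mixture [set: X] = 1%E.
Proof.
have -> : mixture setT =
    ((1 - a%:num)%:E * P setT + (a%:num)%:E * Q setT)%E.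
  by rewrite /mixture measure_addE.
by rewrite !probability_setT !mule1 -EFinD subrK.
Qed.

HB.instance Definition _ := Measure_isProbability.Build _ _ _
  mixture mixture_setT.

End mixture.

Section detection.
Context {R : realType}.

Definition P0 (d : nat) : probability (euclid R d) R := gaussian (fun=> 0).

Definition shift {d : nat} (beta : R) (S : {set 'I_d}) (j : 'I_d) : R :=
  if j \in S then beta else 0.

Definition PS {d : nat} (alpha : {i01 R}) (beta : R) (S : {set 'I_d}) :
    probability (euclid R d) R :=
  mixture alpha (P0 d) (gaussian (shift beta S)).

Definition sparse_sets (d s : nat) : {set {set 'I_d}} :=
  [set S : {set 'I_d} | #|S| == s].

Definition queries (d : nat) (b : R) : set (euclid R d -> R) :=
  [set q | measurable_fun [set: euclid R d] q /\ forall x, - b <= q x <= b].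

Definition tau (n : nat) (xi : R) : \bar R :=
  if xi == 0 then +oo%E else (Num.sqrt (ln xi^-1 / n%:R))%:E.

Definition tau_query {d : nat} (b : R) (n : nat) (xi : R)
    (q : euclid R d -> R) : \bar R :=
  if xi == 0 then +oo%E else
  (Num.max (2 * b / 3 * (ln xi^-1 / n%:R))
    (Num.sqrt (2 * fine 'V_(P0 d)[q] * ln xi^-1 / n%:R)))%:E.

Definition distinguished {d : nat} (b : R) (s n : nat) (alpha : {i01 R})
    (beta xi : R) (q : euclid R d -> R) : {set {set 'I_d}} :=
  [set S in sparse_sets d s |
    `[< (tau_query b n xi q <
         `| 'E_(PS alpha beta S)[q] - 'E_(P0 d)[q] |)%E >]].

Definition sup_distinguished (d : nat) (b : R) (s n : nat)
    (alpha : {i01 R}) (beta xi : R) : R :=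
  sup [set (#|distinguished b s n alpha beta xi q|)%:R
      | q in queries (d := d) b].

(* The limit exists in [0, +oo] and is positive. *)
Definition lim_positive (u : nat -> \bar R) : Prop :=
  exists2 l : \bar R, (0 < l)%E & u @ \oo --> l.

End detection.

(* Main.v *)
Require Import Defs.
From mathcomp Require Import all_boot all_order all_algebra.
From mathcomp Require Import all_classical all_reals all_analysis.
From mathcomp Require Import measurable_realfun ring lra zify.

Set Implicit Arguments.
Unset Strict Implicit.
Unset Printing Implicit Defensive.

Import Order.TTheory GRing.Theory Num.Theory.
Import numFieldNormedType.Exports.

Local Open Scope classical_set_scope.
Local Open Scope ring_scope.

(* Let A be the set of S detected by q with a given sign. Cauchy-Schwarz for
   the covariance of q with the sum over A of the likelihood ratios, whose
   covariances are exp(beta^2 |S n S'|) - 1, shows that the mean of exp(beta^2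
   |S n S'|) over A x A exceeds 1 + 2 tau^2 / alpha^2.

   Conversely, if A has at least a fraction d^(-h) of all s-subsets, this mean
   is at most exp(C_h beta^2 (1 + s^2/d)). This is a hypercontractive
   estimate: for S, S' with independent coordinates of bias s/d the kernel (1
   + k)^|S n S'| tensorizes over coordinates, and a two-point inequality
   bounds the form on indicators by mass^(2 - 2g) with g of order k / log d,
   so that the loss d^(2gh) is only exp(O(k h)). Conditioning on |S| = s costs
   a factor d + 1, since s is the mode of the binomial law.

   In each regime beta^2 (1 + s^2/d) tends to 0 and is negligible against
   tau^2 / alpha^2, so A is eventually smaller than any power of d allows. *)

(** * Likelihood ratios and second moments *)

Section likelihood.
Context {R : realType}.
Local Notation mu := (@lebesgue_measure R).

(** The abstract Radon-Nikodym derivative is a.e. [normal_pdf], because both have the same integral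
    over every measurable set. *)
Lemma integral_normal_prob (m s : R) (f : R -> \bar R) :
  (forall x, 0 <= f x)%E -> measurable_fun setT f ->
  (\int[normal_prob m s]_x f x = \int[mu]_x (f x * (normal_pdf m s x)%:E))%E.
Proof.
move=> f0 mf; have dom := normal_prob_dominates m s.
rewrite -(Radon_Nikodym_SigmaFinite.change_of_variables dom)//.
apply: ae_eq_integral => //.
- apply: emeasurable_funM => //.
  exact: measurable_int (Radon_Nikodym_SigmaFinite.f_integrable dom).
- apply: emeasurable_funM => //.
  by apply/measurable_EFinP; exact: measurable_normal_pdf.
- apply: ae_eqe_mul2l; apply: integral_ae_eq => //=.
  + exact: Radon_Nikodym_SigmaFinite.f_integrable.
  + by apply/measurable_EFinP; exact: measurable_normal_pdf.
  + by move=> E _ mE; rewrite -Radon_Nikodym_SigmaFinite.f_integral.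
Qed.

Lemma normal_pdf_shift (m x : R) :
  normal_pdf m 1 x = normal_pdf 0 1 x * expR (m * x - m ^+ 2 / 2).
Proof.
rewrite !normal_pdfE ?oner_eq0// /normal_fun -mulrA -expRD.
by congr (_ * expR _); field.
Qed.

Lemma measurable_tilt (m : R) :
  measurable_fun [set: R] (fun x => expR (m * x - m ^+ 2 / 2)).
Proof. by apply: measurableT_comp => //; apply: measurable_funB. Qed.

Lemma integral_normal_shift (m : R) (f : R -> \bar R) :
  (forall x, 0 <= f x)%E -> measurable_fun setT f ->
  (\int[normal_prob m 1]_x f x =
   \int[normal_prob 0 1]_x (f x * (expR (m * x - m ^+ 2 / 2))%:E))%E.
Proof.
move=> f0 mf; rewrite integral_normal_prob// integral_normal_prob.
- by apply: eq_integral => x _; rewrite normal_pdf_shift mulrC EFinM muleA.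
- by move=> x; rewrite mule_ge0// lee_fin expR_ge0.
- by apply: emeasurable_funM => //; apply/measurable_EFinP; exact: measurable_tilt.
Qed.

(** The density dN(theta, I_d) / dN(0, I_d), as [integral_gaussian] proves. *)
Definition likelihood {d : nat} (theta : 'I_d -> R) (x : euclid R d) : R :=
  expR (\sum_j (theta j * tnth x j - theta j ^+ 2 / 2)).

Lemma likelihood_ge0 {d : nat} (theta : 'I_d -> R) x : 0 <= likelihood theta x.
Proof. exact: expR_ge0. Qed.

Lemma measurable_likelihood {d : nat} (theta : 'I_d -> R) :
  measurable_fun setT (likelihood theta).
Proof.
apply: measurableT_comp => //; apply: measurable_sum => j.
apply: measurable_funB => //; apply: measurable_funM => //.
exact: measurable_tnth.
Qed.

(** Tonelli. Having a density is phrased through integrals of nonnegative functions, the form in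
    which the induction of [integral_gaussian] supplies it. *)
Lemma integral_prod_density d1 d2 (T1 : measurableType d1)
    (T2 : measurableType d2) (P1 Q1 : probability T1 R)
    (P2 Q2 : probability T2 R) (l1 : T1 -> R) (l2 : T2 -> R)
    (f : T1 * T2 -> \bar R) :
  measurable_fun setT l1 -> measurable_fun setT l2 ->
  (forall x, 0 <= l1 x) -> (forall x, 0 <= l2 x) ->
  (forall g : T1 -> \bar R, (forall x, 0 <= g x)%E -> measurable_fun setT g ->
    (\int[P1]_x g x = \int[Q1]_x (g x * (l1 x)%:E))%E) ->
  (forall g : T2 -> \bar R, (forall x, 0 <= g x)%E -> measurable_fun setT g ->
    (\int[P2]_x g x = \int[Q2]_x (g x * (l2 x)%:E))%E) ->
  (forall z, 0 <= f z)%E -> measurable_fun setT f ->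
  (\int[P1 \x P2]_z f z =
   \int[Q1 \x Q2]_z (f z * (l1 z.1 * l2 z.2)%:E))%E.
Proof.
move=> ml1 ml2 l10 l20 PQ1 PQ2 f0 mf.
pose g z := (f z * (l2 z.2)%:E)%E.
have g0 z : (0 <= g z)%E by rewrite mule_ge0// lee_fin.
have mg : measurable_fun setT g.
  apply: emeasurable_funM => //; apply/measurable_EFinP.
  exact: measurableT_comp.
have h0 z : (0 <= f z * (l1 z.1 * l2 z.2)%:E)%E.
  by rewrite mule_ge0// lee_fin mulr_ge0.
have mh : measurable_fun setT (fun z => f z * (l1 z.1 * l2 z.2)%:E)%E.
  apply: emeasurable_funM => //; apply/measurable_EFinP.
  by apply: measurable_funM; exact: measurableT_comp.
rewrite (fubini_tonelli1 _ mf f0) (fubini_tonelli1 _ mh h0).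
transitivity (\int[P1]_x fubini_F Q2 g x)%E.
  apply: eq_integral => x _; rewrite /fubini_F PQ2//.
  exact: (measurableT_comp mf (measurable_pair1 x)).
rewrite PQ1; last 2 first.
- by move=> x; exact: integral_ge0.
- exact: measurable_fun_fubini_tonelli_F.
apply: eq_integral => x _; rewrite /fubini_F -ge0_integralZr//.
- by apply: eq_integral => y _; rewrite /g /= -muleA -EFinM [l2 y * _]mulrC.
- exact: (measurableT_comp mg (measurable_pair1 x)).
- by rewrite lee_fin.
Qed.

Lemma integral_gaussian {d : nat} (theta : 'I_d -> R) (f : euclid R d -> \bar R) :
  (forall x, 0 <= f x)%E -> measurable_fun setT f ->
  (\int[gaussian theta]_x f x = \int[P0 d]_x (f x * (likelihood theta x)%:E))%E.
Proof.
elim: d theta f => [|d IH] theta f f0 mf.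
  by apply: eq_integral => x _; rewrite /likelihood big_ord0 expR0 mule1.
have flik0 x : (0 <= f x * (likelihood theta x)%:E)%E.
  by rewrite mule_ge0// lee_fin likelihood_ge0.
have mflik : measurable_fun setT (fun x => f x * (likelihood theta x)%:E)%E.
  apply: emeasurable_funM => //; apply/measurable_EFinP.
  exact: measurable_likelihood.
pose theta' := fun j => theta (lift ord0 j).
transitivity (\int[normal_prob (theta ord0) 1 \x gaussian theta']_z
    f (prepend z))%E; first exact: ge0_integral_distribution.
transitivity (\int[normal_prob 0 1 \x P0 d]_z
    (f (prepend z) * (likelihood theta (prepend z))%:E))%E; last first.
  by apply/esym; apply: (ge0_integral_distribution _ mflik).
pose l1 (x : measurableTypeR R) := expR (theta ord0 * x - theta ord0 ^+ 2 / 2).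
have ml1 : measurable_fun setT l1 by exact: measurable_tilt.
have mfp : measurable_fun setT (f \o @prepend R d) by exact: measurableT_comp.
have l10 x : 0 <= l1 x by exact: expR_ge0.
have normal_l1 g : (forall x, 0 <= g x)%E -> measurable_fun setT g ->
    (\int[normal_prob (theta ord0) 1]_x g x =
     \int[normal_prob 0 1]_x (g x * (l1 x)%:E))%E.
  by move=> g0 mg; exact: integral_normal_shift.
have fp0 z : (0 <= (f \o prepend) z)%E by exact: f0.
have E := integral_prod_density ml1 (measurable_likelihood theta') l10
  (likelihood_ge0 theta') normal_l1 (IH theta') fp0 mfp.
apply: (etrans E).
apply: eq_integral => -[x z] _; congr (_ * _%:E)%E.
rewrite /l1 /likelihood -expRD big_ord_recl tnth0.
by under [in RHS]eq_bigr do rewrite tnthS.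
Qed.

(** * Covariances of likelihood ratios and queries *)

Lemma Lfun2P dd (T : measurableType dd) (P : probability T R) (f : T -> R) :
  measurable_fun setT f -> (\int[P]_x (f x ^+ 2)%:E < +oo)%E ->
  f \in Lfun P 2%:E.
Proof.
move=> mf foo; rewrite inE; apply/andP; split; rewrite inE//=.
rewrite /finite_norm unlock /= poweR_lty//.
rewrite (eq_integral (fun x => (f x ^+ 2)%:E))// => x _.
by rewrite powR_mulrn// real_normK// num_real.
Qed.

Lemma integral_likelihood {d : nat} (theta : 'I_d -> R) :
  (\int[P0 d]_x (likelihood theta x)%:E = 1)%E.
Proof.
under eq_integral do rewrite -[(likelihood _ _)%:E]mul1e.
rewrite -(integral_gaussian theta (f := cst 1%E))//.
by rewrite integral_cst//= probability_setT mule1.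
Qed.

(** Log-likelihoods are affine in [x], so a product of two likelihood ratios is a multiple of a
    third. That one has mean 1, which makes all second moments explicit. *)
Lemma likelihoodM {d : nat} (theta theta' : 'I_d -> R) x :
  likelihood theta x * likelihood theta' x =
  expR (\sum_j theta j * theta' j) * likelihood (fun j => theta j + theta' j) x.
Proof.
rewrite /likelihood -!expRD -!big_split; congr expR; apply: eq_bigr => j _ /=.
by field.
Qed.

Lemma integral_likelihoodM {d : nat} (theta theta' : 'I_d -> R) :
  (\int[P0 d]_x (likelihood theta x * likelihood theta' x)%:E =
   (expR (\sum_j theta j * theta' j))%:E)%E.
Proof.
under eq_integral do rewrite likelihoodM EFinM.
rewrite ge0_integralZl ?integral_likelihood ?mule1//.
- by apply/measurable_EFinP; exact: measurable_likelihood.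
- by move=> x _; rewrite lee_fin likelihood_ge0.
Qed.

Lemma likelihood_Lfun2 {d : nat} (theta : 'I_d -> R) :
  likelihood theta \in Lfun (P0 d) 2%:E.
Proof.
apply: Lfun2P; first exact: measurable_likelihood.
by under eq_integral do rewrite expr2; rewrite integral_likelihoodM ltry.
Qed.

Lemma expectation_likelihood {d : nat} (theta : 'I_d -> R) :
  ('E_(P0 d)[likelihood theta] = 1)%E.
Proof. by rewrite unlock integral_likelihood. Qed.

Lemma Lfun2_Lfun1 dd (T : measurableType dd) (P : probability T R) :
  {subset Lfun P 2%:E <= Lfun P 1%E}.
Proof. by apply: Lfun_subset12; exact: fin_num_measure. Qed.

Lemma covariance_likelihood {d : nat} (theta theta' : 'I_d -> R) :
  covariance (P0 d) (likelihood theta) (likelihood theta') =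
  (expR (\sum_j theta j * theta' j) - 1)%:E.
Proof.
rewrite covarianceE ?Lfun2_mul_Lfun1 ?Lfun2_Lfun1 ?likelihood_Lfun2//.
rewrite !expectation_likelihood mule1 EFinB; congr (_ - _)%E.
by rewrite unlock integral_likelihoodM.
Qed.

Lemma bounded_Lfun2 dd (T : measurableType dd) (P : probability T R)
    (b : R) (q : T -> R) :
  measurable_fun setT q -> (forall x, - b <= q x <= b) -> q \in Lfun P 2%:E.
Proof.
move=> mq qb; apply: Lfun2P => //.
apply: (@le_lt_trans _ _ (\int[P]_x (b ^+ 2)%:E)%E); last first.
  by rewrite integral_cst//= probability_setT mule1 ltry.
apply: ge0_le_integral => //.
- by move=> x _; rewrite lee_fin sqr_ge0.
- by apply/measurable_EFinP; exact: measurable_funX.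
- by move=> x _; rewrite lee_fin; have := qb x; nra.
Qed.

Lemma expectation_gaussian {d : nat} (b : R) (theta : 'I_d -> R)
    (q : euclid R d -> R) : queries b q ->
  ('E_(gaussian theta)[q] = 'E_(P0 d)[q \* likelihood theta])%E.
Proof.
case=> mq qb.
have q1 (P : probability (euclid R d) R) : q \in Lfun P 1%E.
  by apply/Lfun2_Lfun1/bounded_Lfun2.
(* The density formula is for nonnegative integrands, so [q] is raised by [b] to [p], with values in
   [0, 2b]. *)
have -> : q = (q \+ cst b) \- cst b by apply/funext => x /=; rewrite addrK.
set p := q \+ cst b.
have mp : measurable_fun setT p by exact: measurable_funD.
have p0 x : (0 <= (p x)%:E)%E by rewrite lee_fin /p/=; have := qb x; lra.
have p2 (P : probability (euclid R d) R) : p \in Lfun P 2%:E.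
  apply: (@bounded_Lfun2 _ _ _ (2 * b)) => // x; rewrite /p/=.
  by have := qb x; lra.
have c2 (P : probability (euclid R d) R) : cst b \in Lfun P 2%:E.
  exact: Lfun_cst.
rewrite expectationB ?Lfun2_Lfun1//.
have -> : (p \- cst b) \* likelihood theta =
    (p \* likelihood theta) \- (b \o* likelihood theta).
  by apply/funext => x /=; rewrite mulrBl [b * _]mulrC.
rewrite expectationB ?Lfun2_mul_Lfun1 ?likelihood_Lfun2//.
rewrite expectationZl ?Lfun2_Lfun1 ?likelihood_Lfun2// expectation_likelihood mule1.
rewrite expectation_cst; congr (_ - _)%E.
rewrite unlock integral_gaussian//.
exact/measurable_EFinP.
Qed.

(** The likelihood ratio has mean 1, so the covariance subtracts exactly the null mean of [q]; this
    is how detection enters Cauchy-Schwarz. *)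
Lemma covariance_query {d : nat} (b : R) (theta : 'I_d -> R)
    (q : euclid R d -> R) : queries b q ->
  covariance (P0 d) q (likelihood theta) =
  ('E_(gaussian theta)[q] - 'E_(P0 d)[q])%E.
Proof.
move=> Qq; have [mq qb] := Qq.
have q2 : q \in Lfun (P0 d) 2%:E by exact: bounded_Lfun2 qb.
rewrite covarianceE ?Lfun2_mul_Lfun1 ?Lfun2_Lfun1 ?likelihood_Lfun2//.
by rewrite expectation_likelihood mule1 (expectation_gaussian theta Qq).
Qed.

Lemma covariance_sumr dd (T : measurableType dd) (P : probability T R)
    (I : Type) (r : seq I) (X : T -> R) (Y : I -> T -> R) :
  X \in Lfun P 2%:E -> (forall i, Y i \in Lfun P 2%:E) ->
  (\sum_(i <- r) Y i) \in Lfun P 2%:E /\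
  covariance P X (\sum_(i <- r) Y i) = (\sum_(i <- r) covariance P X (Y i))%E.
Proof.
move=> X2 Y2; elim: r => [|i r [IH1 IH2]].
  rewrite !big_nil; split; first exact: Lfun_cst.
  exact: covariance_cst_r.
rewrite !big_cons -IH2 covarianceDr//; split=> //.
by rewrite rpredD ?lee1n.
Qed.


Lemma expectation_mixture dd (T : measurableType dd) (a : {i01 R})
    (P Q : probability T R) (b : R) (q : T -> R) :
  measurable_fun setT q -> (forall x, - b <= q x <= b) ->
  ('E_(mixture a P Q)[q] =
   (1 - a%:num)%:E * 'E_P[q] + a%:num%:E * 'E_Q[q])%E.
Proof.
move=> mq qb.
have q1 (P' : probability T R) : q \in Lfun P' 1%E.
  by apply/Lfun2_Lfun1/bounded_Lfun2.
(* The same shift by [b]: integrals against a sum of measures are split for nonnegative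
   integrands. *)
have -> : q = (q \+ cst b) \- cst b by apply/funext => x /=; rewrite addrK.
set p := q \+ cst b.
have mp : measurable_fun setT p by exact: measurable_funD.
have p0 x : (0 <= (p x)%:E)%E by rewrite lee_fin /p/=; have := qb x; lra.
have p1 (P' : probability T R) : p \in Lfun P' 1%E.
  apply/Lfun2_Lfun1/(@bounded_Lfun2 _ _ _ (2 * b)) => // x; rewrite /p/=.
  by have := qb x; lra.
have c1 (P' : probability T R) : cst b \in Lfun P' 1%E by rewrite Lfun2_Lfun1// Lfun_cst.
rewrite !expectationB// !expectation_cst.
have -> : ('E_(mixture a P Q)[p] =
    (1 - a%:num)%:E * 'E_P[p] + a%:num%:E * 'E_Q[p])%E.
  rewrite !unlock.
  have mpE : measurable_fun setT (EFin \o p) by exact/measurable_EFinP.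
  by rewrite ge0_integral_measure_add// !ge0_integral_mscale.
rewrite -(fineK (expectation_fin_num (p1 P))) -(fineK (expectation_fin_num (p1 Q))).
rewrite -!EFinB -!EFinM -!EFinD; congr _%:E; ring.
Qed.

Lemma expectation_query_fin_num {d : nat} (P : probability (euclid R d) R)
    (b : R) (q : euclid R d -> R) : queries b q -> ('E_P[q] \is a fin_num)%E.
Proof. by case=> mq qb; apply/expectation_fin_num/Lfun2_Lfun1/bounded_Lfun2. Qed.

Lemma expectation_PS {d : nat} (alpha : {i01 R}) (beta b : R)
    (S : {set 'I_d}) (q : euclid R d -> R) : queries b q ->
  ('E_(PS alpha beta S)[q] - 'E_(P0 d)[q])%E =
  (alpha%:num%:E * ('E_(gaussian (Defs.shift beta S))[q] - 'E_(P0 d)[q]))%E.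
Proof.
move=> Qq; have [mq qb] := Qq; rewrite (expectation_mixture _ _ _ mq qb).
rewrite -(fineK (expectation_query_fin_num (P0 d) Qq)).
rewrite -(fineK (expectation_query_fin_num (gaussian (Defs.shift beta S)) Qq)).
by rewrite -!(EFinM, EFinD, EFinB, EFinN); congr _%:E; ring.
Qed.

Lemma sum_shiftM {d : nat} (beta : R) (S S' : {set 'I_d}) :
  \sum_j Defs.shift beta S j * Defs.shift beta S' j = beta ^+ 2 * #|S :&: S'|%:R.
Proof.
rewrite (bigID (mem (S :&: S'))) /= [X in _ + X]big1 ?addr0.
  rewrite (eq_bigr (fun=> beta ^+ 2)) ?sumr_const ?mulr_natr// => j.
  by rewrite inE /Defs.shift => /andP[-> ->]; rewrite expr2.
move=> j; rewrite inE /Defs.shift negb_and => /orP[/negbTE ->|/negbTE ->].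
  by rewrite mul0r.
by rewrite mulr0.
Qed.

(** The detection threshold and the Cauchy-Schwarz bound both scale with the standard deviation of
    [q], which therefore cancels and leaves a bound on overlaps alone. The sign of the shift is
    fixed so that shifts add up over [A]. *)
Lemma detected_overlap {d : nat} (b : R) (n : nat) (alpha : {i01 R})
    (beta xi : R) (q : euclid R d -> R) (A : {set {set 'I_d}}) :
  queries b q -> 0 < alpha%:num -> 0 < xi < 1 -> A != finset.set0 ->
  (forall S, S \in A ->
    (tau_query b n xi q < 'E_(PS alpha beta S)[q] - 'E_(P0 d)[q])%E) ->
  #|A|%:R ^+ 2 * (1 + 2 * (ln xi^-1 / n%:R) / alpha%:num ^+ 2) <
  \sum_(S in A) \sum_(S' in A) expR (beta ^+ 2 * #|S :&: S'|%:R).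
Proof.
move=> Qq a0 /andP[xi0 xi1] A0 HA; have [mq qb] := Qq.
have q2 : q \in Lfun (P0 d) 2%:E by exact: bounded_Lfun2 qb.
set v := fine 'V_(P0 d)[q].
have v0 : 0 <= v by rewrite fine_ge0// variance_ge0.
have vE : 'V_(P0 d)[q] = v%:E by rewrite fineK// variance_fin_num.
set L := ln xi^-1 / n%:R.
have L0 : 0 <= L by rewrite divr_ge0// ln_ge0// invf_ge1// ltW.
pose e S := fine 'E_(gaussian (Defs.shift beta S))[q]%E - fine 'E_(P0 d)[q]%E.
have eE S : ('E_(gaussian (Defs.shift beta S))[q] - 'E_(P0 d)[q])%E = (e S)%:E.
  by rewrite EFinB !fineK// (expectation_query_fin_num _ Qq).
have eA S : S \in A -> Num.sqrt (2 * v * L) < alpha%:num * e S.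
  move=> /HA; rewrite (expectation_PS _ _ _ Qq) eE -EFinM /tau_query gt_eqF//.
  (* The threshold is at least its variance term. *)
  rewrite lte_fin; apply: le_lt_trans.
  by rewrite le_max /L !mulrA lexx orbT.
pose lik S := likelihood (Defs.shift beta S) : euclid R d -> R.
have lik2 S : lik S \in Lfun (P0 d) 2%:E by exact: likelihood_Lfun2.
have [Y2 covY] := covariance_sumr (enum A) q2 lik2.
have covqY : covariance (P0 d) q (\sum_(S <- enum A) lik S) =
    (\sum_(S in A) e S)%:E.
  rewrite covY -sumEFin big_enum/=; apply: eq_bigr => S _.
  by rewrite (covariance_query _ Qq) eE.
set G := \sum_(S in A) \sum_(S' in A) (expR (beta ^+ 2 * #|S :&: S'|%:R) - 1).
have varY : 'V_(P0 d)[\sum_(S <- enum A) lik S] = G%:E.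
  rewrite /variance; have [_ ->] := covariance_sumr (enum A) Y2 lik2.
  rewrite -sumEFin big_enum/=; apply: eq_bigr => S _.
  rewrite covarianceC; have [_ ->] := covariance_sumr (enum A) (lik2 S) lik2.
  rewrite -sumEFin big_enum/=; apply: eq_bigr => S' _.
  by rewrite covariance_likelihood sum_shiftM.
have G0 : 0 <= G by rewrite -lee_fin -varY variance_ge0.
have := covariance_le q2 Y2; rewrite covqY vE varY -EFinM lee_fin => DvG.
set D := \sum_(S in A) e S in DvG.
have mD : #|A|%:R * Num.sqrt (2 * v * L) < alpha%:num * D.
  rewrite /D mulr_sumr mulr_natl -sumr_const.
  (* One member of [A] is split off to keep the inequality strict. *)
  have [S0 AS0] := finset.set0Pn _ A0.
  rewrite (bigD1 S0)//= [ltRHS](bigD1 S0)//= ltr_leD ?eA//.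
  by apply: ler_sum => S /andP[AS _]; rewrite ltW// eA.
have m0 : 0 < #|A|%:R :> R by rewrite ltr0n card_gt0.
have D0 : 0 < D.
  by rewrite -(pmulr_rgt0 _ a0) (le_lt_trans _ mD)// mulr_ge0 ?sqrtr_ge0// ltW.
have D2 : D ^+ 2 <= v * G.
  rewrite -(sqr_sqrtr v0) -(sqr_sqrtr G0) -exprMn ler_sqr// nnegrE.
    exact: ltW.
  by rewrite mulr_ge0 ?sqrtr_ge0.
have mD2 : #|A|%:R ^+ 2 * (2 * v * L) < alpha%:num ^+ 2 * D ^+ 2.
  have t0 : 0 <= 2 * v * L by rewrite mulr_ge0// mulr_ge0.
  rewrite -[2 * v * L]sqr_sqrtr// -!exprMn ltr_sqr// nnegrE.
    by rewrite mulr_ge0 ?sqrtr_ge0// ltW.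
  by rewrite mulr_ge0// ltW.
(* Zero variance would give [D ^+ 2 <= 0] against [0 < D]; positivity allows [v] to be cancelled. *)
have v1 : 0 < v.
  by rewrite lt_def v0 andbT; apply: contraTneq D2 => ->; rewrite mul0r -ltNge exprn_gt0.
have key : #|A|%:R ^+ 2 * (2 * L) < alpha%:num ^+ 2 * G.
  rewrite -(ltr_pM2r v1); apply: (le_lt_trans _ (lt_le_trans mD2 _)).
    by rewrite le_eqVlt; apply/orP; left; apply/eqP; ring.
  by rewrite -[leRHS]mulrA ler_pM2l ?exprn_gt0// mulrC.
have -> : \sum_(S in A) \sum_(S' in A) expR (beta ^+ 2 * #|S :&: S'|%:R) =
    #|A|%:R ^+ 2 + G.
  rewrite /G (eq_bigr (fun S : {set 'I_d} => 1 *+ #|A| +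
    \sum_(S' in A) (expR (beta ^+ 2 * #|S :&: S'|%:R) - 1))).
    by rewrite big_split/= sumr_const -mulrnA natrM -expr2.
  move=> S _; rewrite -sumr_const -big_split/=.
  by apply: eq_bigr => S' _; rewrite subrKC.
rewrite mulrDr mulr1 ltrD2l mulrA ltr_pdivrMr ?exprn_gt0// [ltRHS]mulrC.
exact: key.
Qed.

End likelihood.

(** * Hypercontractivity on the biased cube *)

Section hypercontractivity.
Context {R : realType}.

(** Young's inequality with the conjugate exponents 1/g and 1/(1 - g). *)
Lemma weighted_amgm (g x z : R) : 0 < g < 1 -> 0 <= x -> 0 <= z ->
  x `^ g * z `^ (1 - g) <= g * x + (1 - g) * z.
Proof.
move=> /andP[g0 g1] x0 z0.
have g1' : 0 < 1 - g by rewrite subr_gt0.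
have := @conjugate_powR _ (x `^ g) (z `^ (1 - g)) g^-1 (1 - g)^-1
  (powR_ge0 _ _) (powR_ge0 _ _).
rewrite !invr_gt0 !invrK subrKC => /(_ g0 g1' erefl).
rewrite -!powRrM !divff ?gt_eqF// !powRr1//.
by rewrite [x * _]mulrC [z * _]mulrC.
Qed.

(** Cauchy-Schwarz for the form diag(1, k) on the plane, by Lagrange's identity. It passes from the
    quadratic inequality [two_point] to pairs of different indicators. *)
Lemma cauchy_schwarz_pair (k M x x' y y' A B : R) :
  0 <= k -> 0 <= M -> 0 <= A -> 0 <= B ->
  x ^+ 2 + k * y ^+ 2 <= M * A ^+ 2 -> x' ^+ 2 + k * y' ^+ 2 <= M * B ^+ 2 ->
  x * x' + k * (y * y') <= M * (A * B).
Proof.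
move=> k0 M0 A0 B0 hA hB.
have MAB0 : 0 <= M * (A * B) by rewrite !mulr_ge0.
have [neg|pos] := leP (x * x' + k * (y * y')) 0; first exact: le_trans MAB0.
rewrite -ler_sqr ?nnegrE ?(ltW pos)//.
apply: (@le_trans _ _ ((x ^+ 2 + k * y ^+ 2) * (x' ^+ 2 + k * y' ^+ 2))).
  rewrite -subr_ge0.
  have -> : (x ^+ 2 + k * y ^+ 2) * (x' ^+ 2 + k * y' ^+ 2) -
    (x * x' + k * (y * y')) ^+ 2 = k * (x * y' - x' * y) ^+ 2 by ring.
  by rewrite mulr_ge0// sqr_ge0.
have -> : (M * (A * B)) ^+ 2 = (M * A ^+ 2) * (M * B ^+ 2) by ring.
by apply: ler_pM => //; rewrite addr_ge0 ?sqr_ge0// mulr_ge0// sqr_ge0.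
Qed.

(* With [y] the [a1]-share of the mean, the left-hand side is at most the mean
   to the power [2 (1 - g)] times [(P + Q) ^ 2 + k Q ^ 2], where [P + Q <= 1]
   is a Hellinger affinity. Shares [y <= K th] are paid for by the factor on
   the right, larger shares by the deficit [1 - (P + Q)]. *)
Lemma two_point (th g k K a0 a1 : R) :
  0 < th <= 1 -> 0 < g < 1 -> 0 <= k -> 1 <= K -> 0 <= a0 -> 0 <= a1 ->
  (forall y, K * th < y <= 1 -> (th / y) `^ g <= 1 - g - k * y) ->
  ((1 - th) * a0 `^ (1 - g) + th * a1 `^ (1 - g)) ^+ 2
    + k * (th * a1 `^ (1 - g)) ^+ 2 <=
  (1 + k * K ^+ 2 * th ^+ 2) * (((1 - th) * a0 + th * a1) `^ (1 - g)) ^+ 2.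
Proof.
move=> /andP[th0 th1] /andP[g0 g1] k0 K1 a00 a10 Hw.
have g1' : 1 - g != 0 by rewrite subr_eq0 gt_eqF.
have g1p : 0 < 1 - g by rewrite subr_gt0.
have th1' : 0 <= 1 - th by rewrite subr_ge0.
set a := (1 - th) * a0 + th * a1.
have a_ge0 : 0 <= a by rewrite addr_ge0// mulr_ge0// ltW.
(* Writing [c] as c^g c^(1-g) separates the weight [c] of an atom from its contribution [c * x] to
   the mean. *)
have split c x : 0 <= c -> 0 <= x -> c * x `^ (1 - g) = c `^ g * (c * x) `^ (1 - g).
  move=> c0 x0; rewrite powRM// mulrA; congr (_ * _).
  rewrite -powRD ?subrKC ?powRr1//.
  by apply/implyP; rewrite oner_eq0.
(* If the mean vanishes, so do both its terms, and 0 to the nonzero power [1 - g] is 0. *)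
have [a0E|aN0] := eqVneq a 0.
  have /eqP := a0E; rewrite paddr_eq0 ?mulr_ge0// ?(ltW th0)// => /andP[/eqP u0 /eqP v0].
  rewrite (split (1 - th))// u0 (split th) ?(ltW th0)// v0 a0E powR0//.
  by rewrite !mulr0 addr0 expr0n /= !mulr0 addr0.
have a_gt0 : 0 < a by rewrite lt_def aN0.
pose y := th * a1 / a.
have y0 : 0 <= y by rewrite divr_ge0// mulr_ge0// ltW.
have yE : th * a1 = y * a by rewrite /y divfK.
have y1E : (1 - th) * a0 = (1 - y) * a by rewrite [RHS]mulrBl -yE mul1r /a addrK.
have y1 : y <= 1.
  by rewrite /y ler_pdivrMr// mul1r /a lerDr mulr_ge0.
have y1' : 0 <= 1 - y by rewrite subr_ge0.
pose P := (1 - th) `^ g * (1 - y) `^ (1 - g).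
pose Q := th `^ g * y `^ (1 - g).
have PE : (1 - th) * a0 `^ (1 - g) = P * a `^ (1 - g).
  by rewrite split// y1E powRM// mulrA.
have QE : th * a1 `^ (1 - g) = Q * a `^ (1 - g).
  by rewrite split ?(ltW th0)// yE powRM// mulrA.
rewrite PE QE; move: (a `^ _) => c.
have -> : (P * c + Q * c) ^+ 2 + k * (Q * c) ^+ 2 =
  ((P + Q) ^+ 2 + k * Q ^+ 2) * c ^+ 2 by ring.
apply: ler_wpM2r; first exact: sqr_ge0.
have P0 : 0 <= P by rewrite mulr_ge0// powR_ge0.
have Q0 : 0 <= Q by rewrite mulr_ge0// powR_ge0.
have PY : P <= g * (1 - th) + (1 - g) * (1 - y).
  by apply: weighted_amgm => //; rewrite g0.
have QY : Q <= g * th + (1 - g) * y.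
  by apply: weighted_amgm => //; rewrite ?g0// ltW.
have PQ1 : P + Q <= 1 by nra.
have [yK|yK] := leP y (K * th).
  have QK : Q <= K * th.
    have Kth : 0 <= K * th by rewrite mulr_ge0 ?(ltW th0)// (le_trans ler01).
    apply: (@le_trans _ _ (th `^ g * (K * th) `^ (1 - g))).
      apply: ler_wpM2l; first exact: powR_ge0.
      by apply: ge0_ler_powR; rewrite ?nnegrE// ltW.
    rewrite powRM ?(ltW th0)// ?(le_trans ler01)// mulrCA.
    have <- : th = th `^ g * th `^ (1 - g).
      by have := split th 1 (ltW th0) ler01; rewrite powR1 !mulr1.
    have KK : K `^ (1 - g) <= K by rewrite ler1_powR// gerBl ltW.
    by rewrite ler_wpM2r// ltW.
  have : (P + Q) ^+ 2 <= 1 by rewrite expr_le1// addr_ge0.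
  have : Q ^+ 2 <= (K * th) ^+ 2 by rewrite ler_sqr// nnegrE// (le_trans Q0).
  by move=> QK2 PQ2; rewrite -mulrA -exprMn lerD// ler_wpM2l.
have y_gt0 : 0 < y.
  by rewrite (le_lt_trans _ yK)// mulr_ge0 ?(ltW th0)// (le_trans ler01).
have {Hw} := Hw y; rewrite yK y1 => /(_ isT).
set w := (th / y) `^ g => Hw.
have w0 : 0 <= w by exact: powR_ge0.
have w1 : w <= 1 by have : 0 <= k * y by [exact: mulr_ge0]; lra.
have QwE : Q = y * w.
  rewrite /w powRM ?invr_ge0// ?(ltW th0)// mulrCA; congr (_ * _).
  rewrite powRB ?powRr1//; last by rewrite gt_eqF ?implybT.
  by congr (_ * _); rewrite -[y^-1]powR_inv1// -powRrM mulN1r powRN.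
have kyy : 0 <= k * y ^+ 2 by rewrite mulr_ge0// sqr_ge0.
(* With [Q = y * w], the hypothesis on [w] leaves a deficit [k * y ^+ 2], which pays for
   [k * Q ^+ 2] since [w <= 1]. *)
have PQ : P + Q <= 1 - k * y ^+ 2.
  have : P <= 1 - y + g * y by nra.
  have : y * w <= y * (1 - g - k * y) by rewrite ler_wpM2l.
  rewrite QwE; nra.
have PQ2 : (P + Q) ^+ 2 <= P + Q.
  by rewrite expr2 ler_piMr// addr_ge0.
have Q2 : k * Q ^+ 2 <= k * y ^+ 2.
  by rewrite ler_wpM2l// QwE exprMn ler_piMr ?sqr_ge0// expr_le1.
have : 0 <= k * K ^+ 2 * th ^+ 2 by rewrite mulr_ge0 ?sqr_ge0// mulr_ge0// sqr_ge0.
by lra.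
Qed.

(** * Tensorization over the coordinates *)

Section tensor.
Variables (I : finType) (th g k M : R).
Hypotheses (th01 : 0 < th <= 1) (g01 : 0 < g < 1) (k0 : 0 <= k) (M0 : 0 <= M).
Hypothesis H2 : forall a0 a1 : R, 0 <= a0 -> 0 <= a1 ->
  ((1 - th) * a0 `^ (1 - g) + th * a1 `^ (1 - g)) ^+ 2
    + k * (th * a1 `^ (1 - g)) ^+ 2 <=
  M * (((1 - th) * a0 + th * a1) `^ (1 - g)) ^+ 2.

(** Law on the subsets of [U] with independent coordinates of bias [th]. The ground set is a
    parameter so that coordinates can be added one at a time. *)
Definition bernoulli_weight (U S : {set I}) : R :=
  \prod_(i in U) (if i \in S then th else 1 - th).

Definition bernoulli_mass (U : {set I}) (a : pred {set I}) : R :=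
  \sum_(S : {set I} | S \subset U) (a S)%:R * bernoulli_weight U S.

(** The kernel is the product over coordinates of 1 + k [i in both S and S']. Two predicates are
    kept because fixing the two values of a coordinate produces mixed pairs. *)
Definition overlap_form (U : {set I}) (a b : pred {set I}) : R :=
  \sum_(S : {set I} | S \subset U) \sum_(S' : {set I} | S' \subset U)
   (a S)%:R * (b S')%:R * bernoulli_weight U S * bernoulli_weight U S'
   * (1 + k) ^+ #|S :&: S'|.

Lemma sum_subsetU1 (V : nmodType) (x : I) (U : {set I}) (F : {set I} -> V) :
  x \notin U ->
  \sum_(S : {set I} | S \subset x |: U) F S =
  \sum_(S : {set I} | S \subset U) (F S + F (x |: S)).
Proof.
move=> xU; rewrite big_split /= (bigID (fun S : {set I} => x \notin S)) /=.
congr (_ + _).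
  apply: eq_bigl => S; apply/andP/idP => [[SU xS]|SU].
    by rewrite -(finset.setU1K xU) finset.subsetD1 SU.
  split; first exact: (fintype.subset_trans SU (finset.subsetUr _ _)).
  by apply: contra xU; exact: (fintype.subsetP SU).
rewrite (reindex_onto (fun S => x |: S) (fun S => S :\ x)) /=.
  apply: eq_bigl => S; rewrite negbK finset.setU11 andbT.
  apply/andP/idP => [[xSU /eqP <-]|SU].
    rewrite finset.subDset; exact: xSU.
  have xS : x \notin S by apply: contra xU; exact: (fintype.subsetP SU).
  by rewrite finset.setU1K// eqxx finset.setUS.
by move=> S /andP[_]; rewrite negbK => xS; exact: finset.setD1K.
Qed.

Lemma bernoulli_weightU1 (x : I) (U S : {set I}) : x \notin U -> x \notin S ->
  bernoulli_weight (x |: U) S = (1 - th) * bernoulli_weight U S /\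
  bernoulli_weight (x |: U) (x |: S) = th * bernoulli_weight U S.
Proof.
move=> xU xS; rewrite /bernoulli_weight !finset.big_setU1//= (negbTE xS) finset.setU11.
split=> //; congr (_ * _); apply: eq_bigr => i iU.
rewrite finset.in_setU1; case: eqVneq => [ix|//].
by rewrite ix (negbTE xU) in iU.
Qed.

Lemma bernoulli_weight_ge0 (U S : {set I}) : 0 <= bernoulli_weight U S.
Proof.
apply: prodr_ge0 => i _; have := th01.
by case: ifP => _ /andP[? ?]; rewrite ?subr_ge0// ltW.
Qed.

Lemma bernoulli_mass_ge0 (U : {set I}) a : 0 <= bernoulli_mass U a.
Proof.
by apply: sumr_ge0 => S _; rewrite mulr_ge0// bernoulli_weight_ge0.
Qed.

Lemma bernoulli_massU1 (x : I) (U : {set I}) (a : pred {set I}) : x \notin U ->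
  bernoulli_mass (x |: U) a =
  (1 - th) * bernoulli_mass U a
    + th * bernoulli_mass U (fun S => a (x |: S)).
Proof.
move=> xU; rewrite /bernoulli_mass sum_subsetU1// !mulr_sumr -big_split.
apply: eq_bigr => S SU.
have xS : x \notin S by apply: contra xU; exact: (fintype.subsetP SU).
have [-> ->] := bernoulli_weightU1 xU xS; rewrite /=; ring.
Qed.

Lemma overlap_formU1 (x : I) (U : {set I}) (a b : pred {set I}) : x \notin U ->
  let a1 S := a (x |: S) in let b1 S := b (x |: S) in
  overlap_form (x |: U) a b =
  (1 - th) ^+ 2 * overlap_form U a b
  + (1 - th) * th * (overlap_form U a b1 + overlap_form U a1 b)
  + th ^+ 2 * (1 + k) * overlap_form U a1 b1.
Proof.
move=> xU a1 b1; rewrite /overlap_form sum_subsetU1// -big_split.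
rewrite !mulr_sumr -!big_split; apply: eq_bigr => S SU /=.
rewrite !sum_subsetU1// -!big_split !mulr_sumr -!big_split.
apply: eq_bigr => S' SU' /=.
have xS : x \notin S by apply: contra xU; exact: (fintype.subsetP SU).
have xS' : x \notin S' by apply: contra xU; exact: (fintype.subsetP SU').
have [-> ->] := bernoulli_weightU1 xU xS.
have [-> ->] := bernoulli_weightU1 xU xS'.
have c1 : #|S :&: (x |: S')| = #|S :&: S'|.
  apply: eq_card => i; rewrite !inE; case: eqVneq => [->|//].
  by rewrite (negbTE xS).
have c2 : #|(x |: S) :&: S'| = #|S :&: S'|.
  apply: eq_card => i; rewrite !inE; case: eqVneq => [->|//].
  by rewrite (negbTE xS') !andbF.
have c3 : #|(x |: S) :&: (x |: S')| = #|S :&: S'|.+1.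
  by rewrite -finset.setUIr finset.cardsU1 inE (negbTE xS).
rewrite c1 c2 c3 exprS /a1 /b1; ring.
Qed.

(** Induction on the ground set: removing a coordinate leaves four forms, each bounded by the
    induction hypothesis, and [H2] with [cauchy_schwarz_pair] bounds their recombination at the cost
    of one factor [M]. *)
Lemma overlap_form_le (U : {set I}) (a b : pred {set I}) :
  overlap_form U a b <=
  M ^+ #|U| * (bernoulli_mass U a `^ (1 - g) * bernoulli_mass U b `^ (1 - g)).
Proof.
move: {2}#|U| (erefl #|U|) => m; elim: m U a b => [|m IH] U a b Um.
  (* On the empty ground set the masses are 0 or 1, values that the power [1 - g] fixes. *)
  have -> : U = finset.set0 by apply/eqP; rewrite -cards_eq0 Um.
  rewrite cards0 expr0 mul1r /overlap_form /bernoulli_mass.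
  have sub0 (S : {set I}) : (S \subset finset.set0) = (S == finset.set0).
    exact: finset.subset0.
  rewrite !(eq_bigl _ _ sub0) !big_pred1_eq (eq_bigl _ _ sub0) big_pred1_eq.
  rewrite /bernoulli_weight !big_set0 finset.setI0 cards0 expr0 !mulr1.
  have g1' : 1 - g != 0 by case/andP: g01 => _ ?; rewrite subr_eq0 gt_eqF.
  by case: (a _); case: (b _); rewrite ?powR1 ?powR0// ?mulr0 ?mul0r ?mulr1.
have [x xU] : exists x, x \in U by apply/finset.set0Pn; rewrite -card_gt0 Um.
have {xU} [xU UE] : x \notin U :\ x /\ U = x |: (U :\ x).
  by rewrite finset.setD11 finset.setD1K.
move: (U :\ x) xU UE => V xV UE; rewrite UE in Um *; clear U UE.
have Vm : #|V| = m by move: Um; rewrite finset.cardsU1 xV => -[].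
have -> : #|x |: V| = #|V|.+1 by rewrite finset.cardsU1 xV.
rewrite overlap_formU1// !bernoulli_massU1// (exprS M).
set a1 := fun S => a (x |: S); set b1 := fun S => b (x |: S).
have := IH _ a b Vm; have := IH _ a b1 Vm; have := IH _ a1 b Vm.
have := IH _ a1 b1 Vm.
set A0 := bernoulli_mass V a; set A1 := bernoulli_mass V a1.
set B0 := bernoulli_mass V b; set B1 := bernoulli_mass V b1.
have := H2 (bernoulli_mass_ge0 V a) (bernoulli_mass_ge0 V a1).
have := H2 (bernoulli_mass_ge0 V b) (bernoulli_mass_ge0 V b1).
rewrite -/A0 -/A1 -/B0 -/B1.
set Z := M ^+ #|V|; have Z0 : 0 <= Z by exact: exprn_ge0.
set al := ((1 - th) * A0 + th * A1) `^ (1 - g).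
set be := ((1 - th) * B0 + th * B1) `^ (1 - g).
move: (A0 `^ _) (A1 `^ _) (B0 `^ _) (B1 `^ _) => p0 p1 q0 q1 hb ha h11 h10 h01 h00.
have al0 : 0 <= al by exact: powR_ge0.
have be0 : 0 <= be by exact: powR_ge0.
have [t0 t1] : 0 < th /\ 0 <= 1 - th by case/andP: th01; rewrite subr_ge0.
(* The four bounds recombine into the product of two means plus [k] times the product of the parts
   where the coordinate is present. *)
apply: (@le_trans _ _ (Z * (((1 - th) * p0 + th * p1) * ((1 - th) * q0 + th * q1)
   + k * (th * p1) * (th * q1)))).
  have -> : Z * (((1 - th) * p0 + th * p1) * ((1 - th) * q0 + th * q1)
     + k * (th * p1) * (th * q1)) =
     (1 - th) ^+ 2 * (Z * (p0 * q0)) +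
     (1 - th) * th * (Z * (p0 * q1) + Z * (p1 * q0)) +
     th ^+ 2 * (1 + k) * (Z * (p1 * q1)) by ring.
  apply: lerD; first apply: lerD.
  - by apply: ler_wpM2l => //; exact: sqr_ge0.
  - by apply: ler_wpM2l; [rewrite mulr_ge0// ltW|exact: lerD].
  - by apply: ler_wpM2l => //; rewrite mulr_ge0 ?sqr_ge0// addr_ge0.
rewrite [M * Z]mulrC -[Z * M * _]mulrA; apply: ler_wpM2l => //.
rewrite -[k * _ * _]mulrA;
  by apply: cauchy_schwarz_pair.
Qed.

End tensor.
End hypercontractivity.

(** * Overlaps in large families of sparse sets *)

Section binomial_mode.
Local Open Scope nat_scope.

(** The d + 1 terms [t k] of the expansion of (s + (d - s))^d rise up to k = s and fall afterwards,
    so [t s] is at least their average. *)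
Lemma binomial_mode (d s : nat) : s <= d ->
  d ^ d <= d.+1 * ('C(d, s) * (s ^ s * (d - s) ^ (d - s))).
Proof.
move=> sd; pose t k := 'C(d, k) * (s ^ k * (d - s) ^ (d - k)).
(* The ratio of consecutive terms, cross-multiplied to stay in the naturals. *)
have rec k : k < d -> t k.+1 * (k.+1 * (d - s)) = t k * ((d - k) * s).
  move=> kd; rewrite /t -[in (d - s) ^ (d - k)](subnSK kd) !expnS.
  transitivity ((k.+1 * 'C(d, k.+1)) * (s * s ^ k * ((d - s) * (d - s) ^ (d - k.+1)))).
    by ring.
  by rewrite mul_bin_left; ring.
have up k : k < s -> t k <= t k.+1.
  move=> ks; have kd := leq_trans ks sd.
  rewrite -(@leq_pmul2r ((d - k) * s)); last first.
    by rewrite muln_gt0 subn_gt0 kd (leq_ltn_trans _ ks).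
  by rewrite -rec// leq_mul2l; apply/orP; right; nia.
have down k : s <= k < d -> t k.+1 <= t k.
  move=> /andP[sk kd].
  rewrite -(@leq_pmul2r (k.+1 * (d - s))); last first.
    by rewrite muln_gt0 subn_gt0 (leq_ltn_trans sk kd).
  by rewrite rec// leq_mul2l; apply/orP; right; nia.
have low j : t (s - j) <= t s.
  elim: j => [|j IH]; first by rewrite subn0.
  (* Once [j >= s], truncated subtraction is constantly 0. *)
  have [js|js] := leqP s j; first by have -> : s - j.+1 = s - j by lia.
  apply: leq_trans IH; rewrite -(subnSK js); apply: up; lia.
have high j : s + j <= d -> t (s + j) <= t s.
  elim: j => [|j IH] sjd; first by rewrite addn0.
  rewrite addnS; apply: leq_trans (IH _); last lia.
  by apply: down; lia.
have tk k : k <= d -> t k <= t s.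
  move=> kd; have [ks|sk] := leqP k s.
    by rewrite -(subKn ks); exact: low.
  by rewrite -(subnKC (ltnW sk)); apply: high; lia.
rewrite -{1}(subnK sd) expnDn -[leqRHS]/(d.+1 * t s).
rewrite -[X in X * _](card_ord d.+1) -sum_nat_const; apply: leq_sum => i _.
by have := tk i (ltnSE (ltn_ord i)); rewrite /t [s ^ _ * _]mulnC.
Qed.

End binomial_mode.

(** * From independent coordinates to sets of fixed size *)

Section sparse_overlap.
Context {R : realType}.

Lemma expRN_le (x : R) : 0 <= x -> expR (- x) <= (1 + x)^-1.
Proof.
move=> x0; rewrite expRN lef_pV2 ?posrE ?expR_gt0 ?expR_ge1Dx//.
by rewrite ltr_wpDr.
Qed.

Lemma binomial_mass_ge (d s : nat) : (s <= d)%N -> (0 < d)%N ->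
  (d.+1%:R)^-1 <= 'C(d, s)%:R * ((s%:R / d%:R) ^+ s * (1 - s%:R / d%:R) ^+ (d - s)) :> R.
Proof.
move=> sd d0; have dR : 0 < d%:R :> R by rewrite ltr0n.
have -> : 1 - s%:R / d%:R = (d - s)%:R / d%:R :> R.
  by rewrite natrB// mulrBl divff ?gt_eqF.
rewrite !exprMn !exprVn.
have -> : 'C(d, s)%:R * (s%:R ^+ s / d%:R ^+ s * ((d - s)%:R ^+ (d - s) / d%:R ^+ (d - s))) =
   ('C(d, s) * (s ^ s * (d - s) ^ (d - s)))%:R / d%:R ^+ d :> R.
  have -> : d%:R ^+ d = d%:R ^+ s * d%:R ^+ (d - s) :> R by rewrite -exprD subnKC.
  rewrite invfM !natrM !natrX; ring.
rewrite ler_pdivlMr ?exprn_gt0// ler_pdivrMl ?ltr0n//.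
by rewrite -natrX -natrM ler_nat binomial_mode.
Qed.

Lemma bernoulli_weight_setT (d s : nat) (th : R) (S : {set 'I_d}) : #|S| = s ->
  bernoulli_weight th finset.setT S = th ^+ s * (1 - th) ^+ (d - s).
Proof.
move=> Ss; rewrite /bernoulli_weight (bigID (mem S)) /=.
rewrite (eq_bigr (fun=> th)); last by move=> i /andP[_ ->].
rewrite [X in _ * X](eq_bigr (fun=> 1 - th)); last by move=> i /andP[_ /negbTE ->].
rewrite !prodr_const.
congr (_ ^+ _ * _ ^+ _).
  by rewrite -Ss; apply: eq_card => i; rewrite -topredE /= finset.in_setT.
have -> : (d - s)%N = #|finset.setC S|.
  by have := finset.cardsC S; rewrite card_ord Ss; lia.
by apply: eq_card => i; rewrite -topredE /= finset.in_setT finset.in_setC.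
Qed.

(** Under the law of bias s/d all s-sets have one weight [w], so the form is w^2 times the double
    sum, the mass is |A| w, and w^2 cancels. The factor d + 1 in the hypothesis turns a fraction of
    the s-sets into mass at least exp(-h). *)
Lemma sparse_overlap_le (d s : nat) (g k K h : R) (A : {set {set 'I_d}}) :
  (0 < s <= d)%N -> 0 < g < 1 -> 0 <= k -> 1 <= K -> 0 <= h ->
  (forall y, K * (s%:R / d%:R) < y <= 1 ->
    (s%:R / d%:R / y) `^ g <= 1 - g - k * y) ->
  A \subset sparse_sets d s ->
  expR (- h) * #|sparse_sets d s|%:R <= #|A|%:R * d.+1%:R^-1 ->
  \sum_(S in A) \sum_(S' in A) (1 + k) ^+ #|S :&: S'| <=
  #|A|%:R ^+ 2 * expR (k * K ^+ 2 * (s%:R ^+ 2 / d%:R) + 2 * g * h).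
Proof.
move=> /andP[s0 sd] g01 k0 K1 h0 Hw As Ah.
have d0 : (0 < d)%N := leq_trans s0 sd.
have dR : 0 < d%:R :> R by rewrite ltr0n.
set th := s%:R / d%:R in Hw.
have th01 : 0 < th <= 1.
  by rewrite divr_gt0 ?ltr0n//= ler_pdivrMr// mul1r ler_nat.
pose M := 1 + k * K ^+ 2 * th ^+ 2.
have e0 : 0 <= k * K ^+ 2 * th ^+ 2 by rewrite mulr_ge0 ?sqr_ge0// mulr_ge0// sqr_ge0.
have M0 : 0 <= M by rewrite addr_ge0.
have H2 a0 a1 (a00 : 0 <= a0) (a10 : 0 <= a1) :=
  two_point th01 g01 k0 K1 a00 a10 Hw.
pose w := th ^+ s * (1 - th) ^+ (d - s).
pose a : pred {set 'I_d} := fun S => S \in A.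
have wS S : S \in A -> bernoulli_weight th finset.setT S = w.
  move=> SA; apply: bernoulli_weight_setT.
  by have := fintype.subsetP As _ SA; rewrite inE => /eqP.
have massE : bernoulli_mass th finset.setT a = #|A|%:R * w.
  rewrite /bernoulli_mass (bigID (mem A)) /= [X in _ + X]big1 ?addr0; last first.
    by move=> S /andP[_ /negbTE SA]; rewrite /a SA mul0r.
  rewrite (eq_bigl (fun S => S \in A)); last by move=> S; rewrite finset.subsetT.
  rewrite (eq_bigr (fun=> w)) ?sumr_const ?mulr_natl// => S SA.
  by rewrite /a SA mul1r wS.
have formE : overlap_form th k finset.setT a a =
    w ^+ 2 * \sum_(S in A) \sum_(S' in A) (1 + k) ^+ #|S :&: S'|.
  rewrite /overlap_form (bigID (mem A)) /= [X in _ + X]big1 ?addr0; last first.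
    by move=> S /andP[_ /negbTE SA]; rewrite big1// => S' _; rewrite /a SA !mul0r.
  rewrite (eq_bigl (fun S => S \in A)); last by move=> S; rewrite finset.subsetT.
  rewrite mulr_sumr; apply: eq_bigr => S SA.
  rewrite (bigID (mem A)) /= [X in _ + X]big1 ?addr0; last first.
    by move=> S' /andP[_ /negbTE SA']; rewrite /a SA' mulr0 !mul0r.
  rewrite (eq_bigl (fun S => S \in A)); last by move=> S'; rewrite finset.subsetT.
  rewrite mulr_sumr; apply: eq_bigr => S' SA'.
  by rewrite /a SA SA' !wS// !mul1r expr2.
have := overlap_form_le th01 g01 k0 M0 H2 finset.setT a a.
rewrite formE massE finset.cardsT card_ord.
have wC : (d.+1%:R)^-1 <= 'C(d, s)%:R * w by exact: binomial_mass_ge.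
have w0 : 0 < w.
  have C1 : 0 < d.+1%:R^-1 :> R by rewrite invr_gt0 ltr0n.
  by have := lt_le_trans C1 wC; rewrite pmulr_rgt0// ltr0n bin_gt0.
have cardC : #|sparse_sets d s| = 'C(d, s) by rewrite card_draws card_ord.
have Aw : expR (- h) <= #|A|%:R * w.
  rewrite cardC in Ah.
  have C0 : 0 < 'C(d, s)%:R :> R by rewrite ltr0n bin_gt0.
  rewrite -(ler_pM2r C0); apply: (le_trans Ah).
  by rewrite -mulrA [w * _]mulrC ler_wpM2l.
have Aw0 : 0 < #|A|%:R * w by rewrite (lt_le_trans _ Aw)// expR_gt0.
set x := #|A|%:R * w in Aw Aw0 *.
(* x^(-g) <= exp(g h) because x >= exp(-h). *)
have xg : x `^ (1 - g) <= x * expR (g * h).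
  have lx : - h <= ln x by rewrite -ler_expR lnK.
  rewrite -{2}(lnK Aw0) -expRD /powR gt_eqF// ler_expR.
  have /andP[g0 _] := g01; have := ler_wpM2l (ltW g0) lx; lra.
(* (1 + u)^d <= exp(u d), and d (s/d)^2 = s^2/d. *)
have Md : M ^+ d <= expR (k * K ^+ 2 * (s%:R ^+ 2 / d%:R)).
  have -> : k * K ^+ 2 * (s%:R ^+ 2 / d%:R) = (k * K ^+ 2 * th ^+ 2) * d%:R.
    by rewrite /th; field; rewrite gt_eqF.
  by rewrite expRM_natr lerXn2r ?nnegrE ?expR_ge0// /M expR_ge1Dx.
move=> main; rewrite -(ler_pM2l (exprn_gt0 2 w0)); apply: (le_trans main).
have -> : w ^+ 2 * (#|A|%:R ^+ 2 * expR (k * K ^+ 2 * (s%:R ^+ 2 / d%:R) + 2 * g * h)) =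
  expR (k * K ^+ 2 * (s%:R ^+ 2 / d%:R)) * ((x * expR (g * h)) * (x * expR (g * h))).
  have -> : 2 * g * h = g * h + g * h by ring.
  rewrite !expRD /x; ring.
by rewrite ler_pM ?exprn_ge0 ?mulr_ge0 ?powR_ge0// ler_pM ?powR_ge0.
Qed.

(* If [s / d >= d ^ (- 1 / 4)] then [s ^ 2 / d >= d ^ (1 / 2)] absorbs [ln d] and
   [g = k] will do; otherwise [g = 32 k / ln d], with enough room both for
   [y >= d ^ (- 1 / 8)], where [y d / s] is a power of [d], and for smaller [y]. *)
Lemma hyper_exponent (d s : nat) (k : R) : (0 < s <= d)%N -> 32 <= ln (d%:R : R) ->
  0 < k <= 6^-1 ->
  exists g : R, [/\ 0 < g < 1,
    forall y, expR 3 * (s%:R / d%:R) < y <= 1 ->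
      (s%:R / d%:R / y) `^ g <= 1 - g - k * y &
    g * ln d%:R <= 32 * k * (1 + s%:R ^+ 2 / d%:R)].
Proof.
move=> /andP[s0 sd] ld /andP[k0 k6].
have d0 : (0 < d)%N := leq_trans s0 sd.
have dR : 0 < d%:R :> R by rewrite ltr0n.
set th := s%:R / d%:R; set l := ln d%:R in ld *.
have l0 : 0 < l by lra.
have th0 : 0 < th by rewrite divr_gt0 ?ltr0n.
have rE : s%:R ^+ 2 / d%:R = d%:R * th ^+ 2.
  by rewrite /th; field; rewrite gt_eqF.
have r0 : 0 <= s%:R ^+ 2 / d%:R :> R by rewrite rE mulr_ge0 ?sqr_ge0// ltW.
have dE : d%:R = expR l by rewrite lnK.
have powle g c y : 0 < g -> 0 < y -> 0 <= c * g -> expR c * th <= y ->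
    (th / y) `^ g <= (1 + c * g)^-1.
  move=> g0 y0 cg cy; apply: (@le_trans _ _ (expR (- (c * g)))); last exact: expRN_le.
  rewrite -mulNr expRM; apply: ge0_ler_powR; rewrite ?nnegrE ?expR_ge0 ?(ltW g0)//.
    by rewrite divr_ge0// ltW.
  by rewrite ler_pdivrMr// expRN mulrC ler_pdivlMr ?expR_gt0// mulrC.
(* The constants exp 3 and 1/6 come from (1 + 3g)(1 - 2g) >= 1 for 0 < g <= 1/6; of the gain 2g, one
   g pays for [k * y]. *)
have small g y : 0 < g <= 6^-1 -> 0 < y -> expR 3 * th < y -> k * y <= g ->
    (th / y) `^ g <= 1 - g - k * y.
  move=> /andP[g0 g6] y0 yK kyg.
  have g30 : 0 <= 3 * g by lra.
  apply: le_trans (powle _ _ _ g0 y0 g30 (ltW yK)) _.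
  suff : (1 + 3 * g)^-1 <= 1 - 2 * g by lra.
  rewrite -div1r ler_pdivrMr; nra.
have [big|sml] := leP (expR (- (l / 4))) th.
  exists k; split; first by rewrite k0 /=; lra.
    move=> y /andP[yK y1]; have y0 : 0 < y.
      by rewrite (lt_trans _ yK)// mulr_gt0 ?expR_gt0.
    by apply: small => //; rewrite ?k0// ler_piMr// ltW.
  (* Here d th^2 >= d^(1/2) = exp(l/2). *)
  have : l / 2 <= d%:R * th ^+ 2.
    apply: (@le_trans _ _ (expR (l / 2))); first by have := expR_ge1Dx (l / 2); lra.
    have -> : l / 2 = l + - (l / 4) + - (l / 4) by field.
    rewrite 2!expRD -dE -mulrA ler_pM2l// expr2.
    by rewrite ler_pM ?expR_ge0.
  rewrite -rE; nra.
(* [l >= 32] makes this at most [k], and [g * l] is exactly [32 * k]. *)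
exists (32 * k / l).
have g0 : 0 < 32 * k / l by rewrite divr_gt0// mulr_gt0.
have gk : 32 * k / l <= k by rewrite ler_pdivrMr// [_ * l]mulrC ler_wpM2r// ltW.
split; first by rewrite g0 /=; lra.
- move=> y /andP[yK y1]; have y0 : 0 < y.
    by rewrite (lt_trans _ yK)// mulr_gt0 ?expR_gt0.
  have [yl|yl] := leP (expR (- (l / 8))) y.
    (* Now y / th >= d^(1/8), which gains a factor (1 + 4k)^-1 <= 1 - 2k; this pays for g <= k and
       for k y <= k. *)
    have e4 : l / 8 * (32 * k / l) = 4 * k by field; rewrite gt_eqF.
    have e40 : 0 <= l / 8 * (32 * k / l) by rewrite e4; lra.
    apply: (@le_trans _ _ (1 + l / 8 * (32 * k / l))^-1).
      apply: powle => //; apply: le_trans yl.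
      have -> : - (l / 8) = l / 8 + - (l / 4) by field.
      by rewrite expRD ler_wpM2l ?expR_ge0// ltW.
    rewrite e4; apply: (@le_trans _ _ (1 - 2 * k)).
      rewrite -div1r ler_pdivrMr; nra.
    have : k * y <= k by rewrite ler_piMr// ltW.
    lra.
  apply: small => //; first by rewrite g0 (le_trans gk).
  (* [k * y <= g] reduces to y l <= 32, which holds since y < exp(-l/8). *)
  rewrite ler_pdivlMr// -mulrA [32 * k]mulrC ler_wpM2l ?(ltW k0)//.
  apply: (@le_trans _ _ (expR (- (l / 8)) * l)); first by rewrite ler_wpM2r// ltW.
  rewrite expRN mulrC ler_pdivrMr ?expR_gt0//.
  have := expR_ge1Dx (l / 8); lra.
- by rewrite divfK ?gt_eqF// ler_peMr ?lerDl// mulr_ge0// ltW.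
Qed.

End sparse_overlap.

(** * Few sets are detected by one query *)

Section detection_bound.
Context {R : realType}.

Lemma expR_le1D2x (x : R) : 0 <= x <= 2^-1 -> expR x <= 1 + 2 * x.
Proof.
move=> /andP[x0 x2].
have : 1 - x <= expR (- x) by rewrite expR_ge1Dx.
have := expRxMexpNx_1 x; have := expR_gt0 x; nra.
Qed.

(** The square of the share threshold exp 3, plus the cost 2 g (h + 2) ln d with g ln d <= 32 k (1 +
    s^2/d). The 2 in h + 2 absorbs d + 1 <= d^2. *)
Definition overlap_const (h : R) : R := expR 3 ^+ 2 + 64 * (h + 2).

(** With k = exp(beta^2) - 1 the kernel (1 + k)^m is exp(beta^2 m). The density d^(-h) enters only
    through g ln d, which [hyper_exponent] keeps of order k (1 + s^2/d). *)
Lemma mean_overlap_le (d s : nat) (beta h : R) (A : {set {set 'I_d}}) :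
  (0 < s <= d)%N -> 32 <= ln (d%:R : R) -> 0 < beta -> beta ^+ 2 <= 12^-1 ->
  0 <= h -> A \subset sparse_sets d s ->
  expR (- (h * ln d%:R)) * #|sparse_sets d s|%:R <= #|A|%:R ->
  \sum_(S in A) \sum_(S' in A) expR (beta ^+ 2 * #|S :&: S'|%:R) <=
  #|A|%:R ^+ 2 *
    expR (overlap_const h * (2 * beta ^+ 2) * (1 + s%:R ^+ 2 / d%:R)).
Proof.
move=> sd ld b0 b12 h0 As Ah; have /andP[s0 sd'] := sd.
have d0 : (0 < d)%N := leq_trans s0 sd'.
have dR : 0 < d%:R :> R by rewrite ltr0n.
have bb0 : 0 < beta ^+ 2 by rewrite exprn_gt0.
pose k := expR (beta ^+ 2) - 1.
have k0 : 0 < k by rewrite subr_gt0 expR_gt1.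
(* With beta^2 <= 1/12 this gives k <= 1/6, as [hyper_exponent] asks. *)
have kb : k <= 2 * beta ^+ 2.
  by rewrite lerBlDl; apply: expR_le1D2x; rewrite ltW//=; lra.
have k6 : 0 < k <= 6^-1 by rewrite k0 /=; lra.
have [g [g01 Hw gl]] := hyper_exponent sd ld k6.
have K1 : 1 <= expR 3 :> R by rewrite -expR0 ler_expR.
have r0 : 0 <= s%:R ^+ 2 / d%:R :> R by rewrite divr_ge0 ?sqr_ge0.
set r := s%:R ^+ 2 / d%:R in gl r0 *.
set l := ln (d%:R : R) in ld gl Ah.
have Ah' : expR (- ((h + 2) * l)) * #|sparse_sets d s|%:R <=
    #|A|%:R * d.+1%:R^-1.
  have -> : - ((h + 2) * l) = - (h * l) - (l + l) by ring.
  rewrite expRD mulrAC ler_pM ?mulr_ge0 ?expR_ge0//.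
  rewrite expRN lef_pV2 ?posrE ?expR_gt0 ?ltr0n// expRD lnK// -natrM ler_nat.
  have : 1 < d%:R :> R by rewrite -[d%:R]lnK// -/l expR_gt1; lra.
  by rewrite ltr1n => d1; rewrite -{1}[d]muln1 ltn_pmul2l.
have hl0 : 0 <= (h + 2) * l by rewrite mulr_ge0; lra.
have := sparse_overlap_le sd g01 (ltW k0) K1 hl0 Hw As Ah'.
have -> : 1 + k = expR (beta ^+ 2) by rewrite /k subrKC.
under eq_bigr do under eq_bigr do rewrite -expRM_natr.
move=> /le_trans; apply; apply: ler_wpM2l; first exact: sqr_ge0.
rewrite ler_expR -/r.
have K0 : 0 <= expR 3 ^+ 2 :> R by exact: sqr_ge0.
have h2 : 0 <= h + 2 by lra.
have t1 : k * expR 3 ^+ 2 * r <= 2 * beta ^+ 2 * expR 3 ^+ 2 * (1 + r).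
  by apply: ler_pM; rewrite ?mulr_ge0 ?(ltW k0)//; [apply: ler_wpM2r|lra].
have t2 : 2 * g * ((h + 2) * l) <= 64 * (h + 2) * (2 * beta ^+ 2) * (1 + r).
  have -> : 2 * g * ((h + 2) * l) = 2 * (h + 2) * (g * l) by ring.
  have -> : 64 * (h + 2) * (2 * beta ^+ 2) * (1 + r) =
    2 * (h + 2) * (32 * (2 * beta ^+ 2) * (1 + r)) by ring.
  apply: ler_wpM2l; first lra.
  apply: (le_trans gl); apply: ler_wpM2r; first lra.
  by apply: ler_wpM2l.
rewrite /overlap_const; lra.
Qed.

(** For a larger [A] the mean overlap would be at most exp z <= 1 + 2z <= 1 + 2 tau^2/alpha^2,
    contradicting [detected_overlap]. *)
Lemma one_sided_fraction (d s n : nat) (b beta xi h : R) (alpha : {i01 R})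
    (q : euclid R d -> R) (A : {set {set 'I_d}}) :
  (0 < s <= d)%N -> 32 <= ln (d%:R : R) -> 0 < beta -> beta ^+ 2 <= 12^-1 ->
  0 <= h -> 0 < alpha%:num -> 0 <= xi < 4^-1 ->
  overlap_const h * (2 * beta ^+ 2) * (1 + s%:R ^+ 2 / d%:R) <= 2^-1 ->
  (xi != 0 -> overlap_const h * (2 * beta ^+ 2) * (1 + s%:R ^+ 2 / d%:R) <=
    ln xi^-1 / n%:R / alpha%:num ^+ 2) ->
  queries b q -> A \subset sparse_sets d s ->
  (forall S, S \in A ->
    (tau_query b n xi q < 'E_(PS alpha beta S)[q] - 'E_(P0 d)[q])%E) ->
  #|A|%:R <= expR (- (h * ln d%:R)) * #|sparse_sets d s|%:R.
Proof.
move=> sd ld b0 b12 h0 a0 /andP[xi0 xi4] small gap Qq As HA.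
have /andP[s0 sd'] := sd.
rewrite leNgt; apply/negP => /ltW large.
have A0 : A != finset.set0.
  have C0 : 0 < #|sparse_sets d s|%:R :> R.
    by rewrite ltr0n card_draws card_ord bin_gt0.
  by rewrite -card_gt0 -(ltr0n R) (lt_le_trans _ large)// mulr_gt0 ?expR_gt0.
(* At [xi = 0] the threshold is +oo and nothing is detected, although [A] is nonempty. *)
have [x0|xN0] := eqVneq xi 0.
  have [S /HA] := finset.set0Pn _ A0.
  by rewrite /tau_query x0 eqxx ltNge leey.
have {}gap := gap xN0.
have xi01 : 0 < xi < 1 by rewrite lt_def xN0 xi0 /=; lra.
have := detected_overlap Qq a0 xi01 A0 HA.
move=> /lt_le_trans/(_ (mean_overlap_le sd ld b0 b12 h0 As large)).
have m0 : 0 < #|A|%:R ^+ 2 :> R by rewrite exprn_gt0// ltr0n card_gt0.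
rewrite ltr_pM2l//; apply/negP; rewrite -leNgt.
set z := overlap_const h * _ * _ in small gap *.
have z0 : 0 <= z.
  rewrite /z /overlap_const; apply: mulr_ge0; last first.
    by rewrite addr_ge0// divr_ge0 ?sqr_ge0.
  apply: mulr_ge0; last by rewrite mulr_ge0 ?sqr_ge0.
  by rewrite addr_ge0 ?sqr_ge0// mulr_ge0// addr_ge0.
apply: le_trans (expR_le1D2x _) _; first by rewrite z0.
by rewrite lerD2l -mulrA ler_wpM2l.
Qed.

(** The factor 2 counts the two signs: a set whose mean shift is negative for [q] is detected with
    positive sign by [- q], which has the same variance and hence the same threshold. *)
Lemma sup_distinguished_le (d s n : nat) (b beta xi h : R) (alpha : {i01 R}) :
  (0 < s <= d)%N -> 32 <= ln (d%:R : R) -> 0 < b -> 0 < beta -> beta ^+ 2 <= 12^-1 ->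
  0 <= h -> 0 < alpha%:num -> 0 <= xi < 4^-1 ->
  overlap_const h * (2 * beta ^+ 2) * (1 + s%:R ^+ 2 / d%:R) <= 2^-1 ->
  (xi != 0 -> overlap_const h * (2 * beta ^+ 2) * (1 + s%:R ^+ 2 / d%:R) <=
    ln xi^-1 / n%:R / alpha%:num ^+ 2) ->
  0 <= sup_distinguished d b s n alpha beta xi <=
    2 * expR (- (h * ln d%:R)) * #|sparse_sets d s|%:R.
Proof.
move=> sd ld b0 beta0 b12 h0 a0 xi4 small gap.
have bound (q : euclid R d -> R) : queries b q -> #|distinguished b s n alpha beta xi q|%:R <=
    2 * expR (- (h * ln d%:R)) * #|sparse_sets d s|%:R.
  move=> Qq; have [mq qb] := Qq.
  pose q' := \- q.
  have Qq' : queries b q'.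
    split; first exact: measurableT_comp.
    by move=> x; rewrite /q' /=; have := qb x; lra.
  pose A p := [set S in sparse_sets d s |
    `[< (tau_query b n xi p < 'E_(PS alpha beta S)[p] - 'E_(P0 d)[p])%E >]]%SET.
  have AP p : queries b p -> #|A p|%:R <= expR (- (h * ln d%:R)) * #|sparse_sets d s|%:R.
    move=> Qp; apply: (one_sided_fraction sd ld beta0 b12 h0 a0 xi4 small gap Qp).
      by apply/fintype.subsetP => S; rewrite inE => /andP[].
    by move=> S; rewrite inE => /andP[_ /asboolP].
  have sub : distinguished b s n alpha beta xi q \subset A q :|: A q'.
    apply/fintype.subsetP => S; rewrite !inE => /andP[-> /asboolP lt]/=.
    have E1 (P : probability (euclid R d) R) : ('E_P[q'] = - 'E_P[q])%E.
      have -> : q' = (-1) \o* q by apply/funext => x /=; rewrite mulrN1.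
      rewrite expectationZl ?mulN1e//.
      by apply/Lfun2_Lfun1/(bounded_Lfun2 _ mq qb).
    have V1 : tau_query b n xi q' = tau_query b n xi q.
      by rewrite /tau_query varianceN//; exact: bounded_Lfun2 qb.
    rewrite V1 !E1; move: lt.
    rewrite -(fineK (expectation_query_fin_num (PS alpha beta S) Qq)).
    rewrite -(fineK (expectation_query_fin_num (P0 d) Qq)).
    set x := fine _; set y := fine _.
    rewrite -!EFinN -!EFinB -opprD => lt.
    have [xy|xy] := leP 0 (x - y); apply/orP; [left|right]; apply/asboolP.
      by move: lt; rewrite gee0_abs ?lee_fin.
    by move: lt; rewrite lte0_abs ?lte_fin.
  apply: (@le_trans _ _ (#|A q|%:R + #|A q'|%:R)).
    rewrite -natrD ler_nat (leq_trans (subset_leq_card sub))//.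
    by rewrite finset.cardsU leq_subr.
  by rewrite -mulrA mulr2n mulrDl !mul1r lerD// AP.
(* The zero query makes the set of counts nonempty; with the bound above, [sup] is then a genuine
   supremum. *)
have Q0 : @queries R d b (cst 0).
  by split; [exact: measurable_cst|move=> x /=; rewrite oppr_le0 ltW//=].
apply/andP; split.
  apply: le_trans (ub_le_sup _ _); last by exists (cst 0).
    by [].
  exists (2 * expR (- (h * ln d%:R)) * #|sparse_sets d s|%:R).
  by move=> _ [q Qq <-]; exact: bound.
apply: ge_sup; first by eexists; exists (cst 0).
by move=> _ [q Qq <-]; exact: bound.
Qed.

Lemma tau2_alpha2E (n : nat) (xi : R) (alpha : {i01 R}) : 0 < xi < 1 ->
  (tau n xi ^+ 2 * (alpha%:num ^- 2)%:E)%E =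
  (ln xi^-1 / n%:R / alpha%:num ^+ 2)%:E.
Proof.
move=> /andP[x0 x1]; rewrite /tau gt_eqF// -EFin_expe -EFinM sqr_sqrtr//.
by rewrite divr_ge0// ln_ge0// invf_ge1// ltW.
Qed.

Lemma tau2_alpha2y (n : nat) (alpha : {i01 R}) : 0 < alpha%:num ->
  (tau n (0 : R) ^+ 2 * (alpha%:num ^- 2)%:E)%E = +oo%E.
Proof.
move=> a0; rewrite /tau eqxx expe2 mulyy gt0_mulye// lte_fin invr_gt0.
by rewrite exprn_gt0.
Qed.

Lemma lim_positive_lower (u : nat -> \bar R) : lim_positive u ->
  exists2 c : R, 0 < c & \forall d \near \oo, (c%:E < u d)%E.
Proof.
move=> [l l0 ul].
have [c c0 cl] : exists2 c : R, 0 < c & (c%:E < l)%E.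
  move: l0; case: l {ul} => [r| |//]; last by move=> _; exists 1; rewrite ?ltry.
  by rewrite lte_fin => r0; exists (r / 2); rewrite ?lte_fin; lra.
exists c => //; apply: (ul [set x | (c%:E < x)%E]).
by apply: open_nbhs_nbhs; split => //; exact: open_ereal_gt_ereal.
Qed.

Lemma cvge0_upper (u : nat -> \bar R) (c : R) : 0 < c -> u @ \oo --> 0%E ->
  \forall d \near \oo, (u d < c%:E)%E.
Proof.
move=> c0 u0; apply: (u0 [set x | (x < c%:E)%E]).
apply: open_nbhs_nbhs; split; last by rewrite /= lte_fin.
exact: open_ereal_lt_ereal.
Qed.

Lemma cvg_ln_natr_ge (M : R) : \forall d \near \oo, M <= ln (d%:R : R).
Proof.
near=> d; rewrite -ler_expR lnK; last first.
  by rewrite posrE ltr0n; near: d; exact: nbhs_infty_gt.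
by near: d; exact: nbhs_infty_ger.
Unshelve. all: by end_near. Qed.

(** * Comparing vanishing sequences with tau^2 / alpha^2 *)

Section regimes.
Variables (n : nat -> nat) (alpha : nat -> {i01 R}) (xi : nat -> R).
Hypotheses (alpha0 : forall d, 0 < (alpha d)%:num)
  (xi4 : forall d, 0 <= xi d < 4^-1) (noo : n @ \oo --> \oo).

Let tau2_alpha2 d : \bar R :=
  (tau (n d) (xi d) ^+ 2 * ((alpha d)%:num ^- 2)%:E)%E.

Let xi01 d : xi d != 0 -> 0 < xi d < 1.
Proof. by move=> xN0; have /andP[x0 x4] := xi4 d; rewrite lt_def xN0 x0 /=; lra. Qed.

(** A sequence tending to 0 falls below both 1/2 and a positive constant that eventually bounds
    tau^2/alpha^2 from below. *)
Lemma below_positive_gap (W : nat -> R) :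
  (forall e, 0 < e -> \forall d \near \oo, W d <= e) ->
  lim_positive tau2_alpha2 ->
  \forall d \near \oo, W d <= 2^-1 /\
    (xi d != 0 -> W d <= ln (xi d)^-1 / (n d)%:R / (alpha d)%:num ^+ 2).
Proof.
move=> W0 /lim_positive_lower[c c0 cT]; near=> d; split.
  by near: d; apply: W0.
move=> xN0; apply: (@le_trans _ _ c); first by near: d; exact: W0.
have : (c%:E < tau2_alpha2 d)%E by near: d.
by rewrite /tau2_alpha2 tau2_alpha2E ?xi01// lte_fin => /ltW.
Unshelve. all: by end_near. Qed.

(** Since xi < 1/4 keeps log(1/xi) above 1/2, tau^2/alpha^2 is at least 1/(2 n alpha^2), so it is
    enough that W n alpha^2 vanishes. *)
Lemma below_vanishing_gap (W : nat -> R) :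
  (forall e, 0 < e -> \forall d \near \oo,
    W d * (n d)%:R * (alpha d)%:num ^+ 2 <= e) ->
  tau2_alpha2 @ \oo --> 0%E ->
  \forall d \near \oo, W d <= 2^-1 /\
    (xi d != 0 -> W d <= ln (xi d)^-1 / (n d)%:R / (alpha d)%:num ^+ 2).
Proof.
move=> W0 T0; near=> d.
have Td : (tau2_alpha2 d < (2^-1)%:E)%E by near: d; exact: cvge0_upper.
(* [xi d = 0] would make tau^2/alpha^2 infinite, but it is already below 1/2. *)
have [x0|xN0] := eqVneq (xi d) 0.
  by move: Td; rewrite /tau2_alpha2 x0 tau2_alpha2y.
have n0 : (0 < n d)%N by near: d; exact: (noo (nbhs_infty_gt 0)).
have nR : 0 < (n d)%:R :> R by rewrite ltr0n.
have a2 : 0 < (alpha d)%:num ^+ 2 by rewrite exprn_gt0.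
have Wg : W d <= ln (xi d)^-1 / (n d)%:R / (alpha d)%:num ^+ 2.
  rewrite ler_pdivlMr// ler_pdivlMr// mulrAC.
  apply: (@le_trans _ _ 2^-1); first by near: d; exact: W0.
  have /andP[x0 x4] := xi4 d.
  have xp : 0 < xi d by rewrite lt_def xN0.
  (* Hence log(1/xi) >= 1 - xi > 3/4. *)
  have : ln (xi d) <= xi d - 1.
    have := expR_ge1Dx (ln (xi d)); rewrite lnK//; lra.
  rewrite lnV ?posrE//; lra.
split=> //; apply: (le_trans Wg).
by move: Td; rewrite /tau2_alpha2 tau2_alpha2E ?xi01// lte_fin => /ltW.
Unshelve. all: by end_near. Qed.

End regimes.

(** [T] costs at most d^|eta|, so a detected fraction of order d^(-h) with h > |eta| is enough. Each
    regime has to supply the last hypothesis; its constant [C] is arbitrary because [overlap_const]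
    depends on eta. *)
Lemma ratio_cvg0 (s n : nat -> nat) (alpha : nat -> {i01 R})
    (beta xi T : nat -> R) (b eta : R) :
  0 < b -> (forall d, (s d <= d)%N) -> (forall d, 0 < (alpha d)%:num) ->
  (forall d, 0 < beta d) -> (forall d, 0 <= xi d < 4^-1) ->
  (forall d, 1 <= T d) -> s @ \oo --> \oo -> beta @ \oo --> 0 ->
  T =O_\oo (fun d => d%:R `^ eta) ->
  (forall C : R, 0 < C -> \forall d \near \oo,
    C * (beta d ^+ 2 * (1 + (s d)%:R ^+ 2 / d%:R)) <= 2^-1 /\
    (xi d != 0 -> C * (beta d ^+ 2 * (1 + (s d)%:R ^+ 2 / d%:R)) <=
      ln (xi d)^-1 / (n d)%:R / (alpha d)%:num ^+ 2)) ->
  (fun d => T d * sup_distinguished d b (s d) (n d) (alpha d) (beta d) (xi d)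
            / #|sparse_sets d (s d)|%:R) @ \oo --> 0.
Proof.
move=> b0 sd a0 beta0 xi4 T1 soo betacvg TO W0.
have [M M0 MT] : exists2 M : R, 0 < M &
  \forall d \near \oo, `|T d| <= M * `|d%:R `^ eta| by exact/eqO_exP.
(* One power of d beyond |eta| leaves a bound of order 1/d. *)
pose h : R := `|eta| + 1.
have h0 : 0 <= h by rewrite addr_ge0.
have C0 : 0 < overlap_const h * 2.
  by rewrite mulr_gt0// ltr_wpDl ?sqr_ge0// mulr_gt0// ltr_wpDl.
apply: (@squeeze_cvgr _ _ _ _ (fun=> 0) (fun d => 2 * M * d%:R^-1)).
- near=> d.
  have sd0 : (0 < s d <= d)%N.
    by rewrite sd andbT; near: d; exact: (soo _ (nbhs_infty_gt 0)).
  have d0 : (0 < d)%N by case/andP: sd0 => /leq_trans; apply.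
  have dR : 0 < d%:R :> R by rewrite ltr0n.
  have ld : 32 <= ln (d%:R : R) by near: d; exact: cvg_ln_natr_ge.
  have b12 : beta d ^+ 2 <= 12^-1.
    have : beta d <= 12^-1 by near: d; apply: (cvgr_le _ betacvg); rewrite invr_gt0.
    have := beta0 d; nra.
  have [small gap] : (overlap_const h * 2) *
      (beta d ^+ 2 * (1 + (s d)%:R ^+ 2 / d%:R)) <= 2^-1 /\
    (xi d != 0 -> (overlap_const h * 2) *
      (beta d ^+ 2 * (1 + (s d)%:R ^+ 2 / d%:R)) <=
      ln (xi d)^-1 / (n d)%:R / (alpha d)%:num ^+ 2) by near: d; exact: W0.
  rewrite (_ : overlap_const h * 2 * _ = overlap_const h * (2 * beta d ^+ 2) *
    (1 + (s d)%:R ^+ 2 / d%:R)) in small gap; last by ring.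
  have /andP[sup0 sup1] := sup_distinguished_le sd0 ld b0 (beta0 d) b12 h0
    (a0 d) (xi4 d) small gap.
  have N0 : 0 < #|sparse_sets d (s d)|%:R :> R.
    by rewrite ltr0n card_draws card_ord bin_gt0 sd.
  have T0 : 0 <= T d by rewrite (le_trans ler01).
  rewrite divr_ge0 ?mulr_ge0// ?(ltW N0)//= ler_pdivrMr//.
  have Td : T d <= M * expR (`|eta| * ln d%:R).
    have : `|T d| <= M * `|d%:R `^ eta| by near: d.
    rewrite ger0_norm// ger0_norm ?powR_ge0// => /le_trans; apply.
    rewrite ler_wpM2l// ?(ltW M0)// /powR gt_eqF// ler_expR ler_wpM2r ?ler_norm//.
    by apply: le_trans ld.
  apply: (le_trans (ler_pM T0 sup0 Td sup1)).
  rewrite mulrA ler_wpM2r// ?(ltW N0)//.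
  have -> : d%:R^-1 = expR (`|eta| * ln d%:R) * expR (- (h * ln d%:R)) :> R.
    rewrite -expRD /h.
    have -> : `|eta| * ln d%:R + - ((`|eta| + 1) * ln d%:R) = - ln (d%:R : R) by ring.
    by rewrite expRN lnK.
  by rewrite le_eqVlt; apply/orP; left; apply/eqP; ring.
- exact: cvg_cst.
- rewrite -[X in _ --> X](mulr0 (2 * M)); apply: cvgM; first exact: cvg_cst.
  apply/gtr0_cvgV0; last exact: cvgr_idn.
  by near=> d; rewrite ltr0n; near: d; exact: nbhs_infty_gt.
Unshelve. all: by end_near. Qed.

End detection_bound.

(** * Reduction of the six regimes to the two comparisons with tau^2 / alpha^2 *)

Theorem theorem5p3 (R : realType) :
  exists2 delta0 : R, 0 < delta0 &
  forall (delta b eta : R) (s n : nat -> nat) (alpha : nat -> {i01 R})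
    (beta xi T : nat -> R),
  0 < delta < delta0 ->
  0 < b ->
  (forall d, (s d <= d)%N) ->
  (forall d, 0 < (alpha d)%:num) ->
  (forall d, 0 < beta d) ->
  (forall d, 0 <= xi d < 4^-1) ->
  (forall d, 1 <= T d) ->
  s @ \oo --> \oo ->
  n @ \oo --> \oo ->
  (fun d => (alpha d)%:num * (n d)%:R) @ \oo --> +oo ->
  beta @ \oo --> 0 ->
  T =O_\oo (fun d => d%:R `^ eta) ->
  let sparsity d : R := (s d)%:R ^+ 2 / d%:R in
  let zeta d : R := d%:R / (2 * (s d)%:R ^+ 2) in
  let zeta_delta d : R := zeta d / d%:R `^ delta in
  let tau2_alpha2 d : \bar R :=
    (tau (n d) (xi d) ^+ 2 * ((alpha d)%:num ^- 2)%:E)%E in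
  let beta2_n_alpha2 d : R :=
    beta d ^+ 2 * (n d)%:R * (alpha d)%:num ^+ 2 in
  [\/ (* (i).(a) *)
      [/\ sparsity @ \oo --> 0,
          lim_positive (EFin \o zeta_delta),
          lim_positive tau2_alpha2 &
          beta @ \oo --> 0],
      (* (i).(b) *)
      [/\ sparsity @ \oo --> 0,
          lim_positive (EFin \o zeta_delta),
          tau2_alpha2 @ \oo --> 0%E &
          beta2_n_alpha2 @ \oo --> 0],
      (* (i).(c) *)
      [/\ sparsity @ \oo --> 0,
          zeta_delta @ \oo --> 0,
          lim_positive tau2_alpha2 &
          (fun d => beta d ^+ 2 * ln d%:R) @ \oo --> 0] |
      [\/ (* (i).(d) *)
          [/\ sparsity @ \oo --> 0,
              zeta_delta @ \oo --> 0,
              tau2_alpha2 @ \oo --> 0%E &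
              beta2_n_alpha2 @ \oo --> 0],
          (* (ii).(a) *)
          [/\ lim_positive (EFin \o sparsity),
              tau2_alpha2 @ \oo --> 0%E &
              (fun d => beta d ^+ 2 * (s d)%:R ^+ 2 * (n d)%:R
                        * (alpha d)%:num ^+ 2 / d%:R) @ \oo --> 0] |
          (* (ii).(b) *)
          [/\ lim_positive (EFin \o sparsity),
              lim_positive tau2_alpha2 &
              (fun d => beta d ^+ 2 * (s d)%:R ^+ 2 * ln d%:R / d%:R)
                @ \oo --> 0]]] ->
  (fun d => T d * sup_distinguished d b (s d) (n d) (alpha d) (beta d) (xi d)
            / #|sparse_sets d (s d)|%:R) @ \oo --> 0.
Proof.
exists 1; first exact: ltr01.
move=> delta b eta s n alpha beta xi T _ b0 sd a0 beta0 xi4 T1 soo noo _ bcvg TO.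
move=> sparsity zeta zeta_delta tau2_alpha2 beta2_n_alpha2 cases.
apply: (ratio_cvg0 b0 sd a0 beta0 xi4 T1 soo bcvg TO) => C C0.
have spE d : sparsity d = (s d)%:R ^+ 2 / d%:R by [].
have sp0 d : 0 <= sparsity d by rewrite divr_ge0 ?sqr_ge0.
have bb0 d : 0 <= beta d ^+ 2 by exact: sqr_ge0.
have na0 d : 0 <= (n d)%:R * (alpha d)%:num ^+ 2 by rewrite mulr_ge0 ?sqr_ge0.
have sparse1 : sparsity @ \oo --> 0 -> \forall d \near \oo, 1 + sparsity d <= 2.
  move=> sp; near=> d.
  have : sparsity d <= 1 by near: d; exact: (cvgr_le _ sp).
  lra.
(* When s^2/d > c eventually, the 1 is at most c^-1 s^2/d, whence D = c^-1 + 1. *)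
have dense1 : lim_positive (EFin \o sparsity) -> exists2 D : R, 0 < D &
    \forall d \near \oo, 1 + sparsity d <= D * sparsity d.
  move=> /lim_positive_lower[c c0 csp]; exists (c^-1 + 1).
    by rewrite addr_gt0 ?invr_gt0.
  near=> d; have : (c%:E < (EFin \o sparsity) d)%E by near: d.
  rewrite /= lte_fin => /ltW cd.
  rewrite mulrDl mul1r lerD2r -ler_pdivrMl ?invr_gt0// invrK mulr1; exact: cd.
have beta2 e : 0 < e -> \forall d \near \oo, beta d ^+ 2 <= e.
  move=> e0; near=> d.
  have : beta d <= Num.min e 1.
    by near: d; apply: (cvgr_le _ bcvg); rewrite lt_min e0 ltr01.
  rewrite le_min => /andP[be b1]; rewrite expr2.
  exact: le_trans (ler_piMr (ltW (beta0 d)) b1) be.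
(* Sparse regimes with tau^2/alpha^2 bounded below: beta^2 (1 + s^2/d) <= 2 beta^2 tends to 0. *)
have A1 : sparsity @ \oo --> 0 -> lim_positive tau2_alpha2 ->
    \forall d \near \oo, C * (beta d ^+ 2 * (1 + (s d)%:R ^+ 2 / d%:R)) <= 2^-1 /\
    (xi d != 0 -> C * (beta d ^+ 2 * (1 + (s d)%:R ^+ 2 / d%:R)) <=
      ln (xi d)^-1 / (n d)%:R / (alpha d)%:num ^+ 2).
  move=> sp0cvg; apply: (below_positive_gap xi4) => e e0; near=> d.
  have r2 : 1 + sparsity d <= 2 by near: d; exact: sparse1.
  have be : beta d ^+ 2 <= e / (C * 2).
    by near: d; apply: beta2; rewrite divr_gt0// mulr_gt0.
  rewrite -spE; move: be; rewrite ler_pdivlMr ?mulr_gt0// => be.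
  by apply: le_trans be; rewrite mulrCA ler_wpM2l// ler_wpM2l// ltW.
(* Sparse regimes with tau^2/alpha^2 vanishing: beta^2 n alpha^2 tends to 0 and 1 + s^2/d <= 2. *)
have B1 : sparsity @ \oo --> 0 -> beta2_n_alpha2 @ \oo --> 0 ->
    tau2_alpha2 @ \oo --> 0%E ->
    \forall d \near \oo, C * (beta d ^+ 2 * (1 + (s d)%:R ^+ 2 / d%:R)) <= 2^-1 /\
    (xi d != 0 -> C * (beta d ^+ 2 * (1 + (s d)%:R ^+ 2 / d%:R)) <=
      ln (xi d)^-1 / (n d)%:R / (alpha d)%:num ^+ 2).
  move=> sp0cvg bn; apply: (below_vanishing_gap a0 xi4 noo) => e e0; near=> d.
  have r2 : 1 + sparsity d <= 2 by near: d; exact: sparse1.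
  have be : beta2_n_alpha2 d <= e / (C * 2).
    by near: d; apply: (cvgr_le _ bn); rewrite divr_gt0// mulr_gt0.
  rewrite -spE; move: be; rewrite ler_pdivlMr ?mulr_gt0// => be.
  apply: le_trans be.
  have -> : C * (beta d ^+ 2 * (1 + sparsity d)) * (n d)%:R * (alpha d)%:num ^+ 2 =
    beta2_n_alpha2 d * (C * (1 + sparsity d)) by rewrite /beta2_n_alpha2; ring.
  apply: ler_wpM2l; first by rewrite /beta2_n_alpha2 -mulrA mulr_ge0.
  by rewrite ler_wpM2l// ltW.
case: cases => [[sp _ tp _]|[sp _ t0 bn]|[sp _ tp _]|[]].
- exact: A1.
- exact: B1.
- exact: A1.
- by case=> sp _ t0 bn; exact: B1.
- case=> /dense1[D D0 spD] t0 bn.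
  apply: (below_vanishing_gap a0 xi4 noo) => // e e0; near=> d.
  have rD : 1 + sparsity d <= D * sparsity d by near: d.
  have be : beta d ^+ 2 * (s d)%:R ^+ 2 * (n d)%:R * (alpha d)%:num ^+ 2 / d%:R <=
      e / (C * D).
    by near: d; apply: (cvgr_le _ bn); rewrite divr_gt0// mulr_gt0.
  rewrite -spE; move: be; rewrite ler_pdivlMr ?mulr_gt0// => be.
  apply: le_trans be.
  have -> : beta d ^+ 2 * (s d)%:R ^+ 2 * (n d)%:R * (alpha d)%:num ^+ 2 / d%:R * (C * D) =
    C * (beta d ^+ 2 * ((n d)%:R * (alpha d)%:num ^+ 2)) * (D * sparsity d).
    rewrite /sparsity; ring.
  have -> : C * (beta d ^+ 2 * (1 + sparsity d)) * (n d)%:R * (alpha d)%:num ^+ 2 =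
    C * (beta d ^+ 2 * ((n d)%:R * (alpha d)%:num ^+ 2)) * (1 + sparsity d) by ring.
  apply: ler_wpM2l => //; apply: mulr_ge0; first exact: ltW.
  exact: mulr_ge0.
- case=> /dense1[D D0 spD] tp bl.
  apply: (below_positive_gap xi4) => // e e0; near=> d.
  have rD : 1 + sparsity d <= D * sparsity d by near: d.
  have l1 : 1 <= ln (d%:R : R) by near: d; exact: cvg_ln_natr_ge.
  have be : beta d ^+ 2 * (s d)%:R ^+ 2 * ln d%:R / d%:R <= e / (C * D).
    by near: d; apply: (cvgr_le _ bl); rewrite divr_gt0// mulr_gt0.
  rewrite -spE; move: be; rewrite ler_pdivlMr ?mulr_gt0// => be.
  apply: le_trans be.
  have -> : beta d ^+ 2 * (s d)%:R ^+ 2 * ln d%:R / d%:R * (C * D) =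
    C * (beta d ^+ 2 * (D * sparsity d)) * ln d%:R.
    rewrite /sparsity; ring.
  (* A factor [ln d%:R >= 1] only increases the right-hand side. *)
  apply: (@le_trans _ _ (C * (beta d ^+ 2 * (D * sparsity d)))).
    by rewrite ler_wpM2l ?(ltW C0)// ler_wpM2l.
  by rewrite ler_peMr// mulr_ge0 ?(ltW C0)// mulr_ge0// mulr_ge0// ltW.
Unshelve. all: by end_near. Qed.
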